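(* Let $\{\lambda_j\}$ be an arbitrary (finite or countable) set of distinct positive numbers. If the set $\{\lambda_j\}$ is finite, then there exist potentials $q\in C^\infty(-\infty,\infty)$ such that (1) for each $j$, the equation $(-D^2+q)u=\lambda_j u$ has a nontrivial solution $u\in L^2(\mathbb{R})$; (2) $|q(x)|=\frac{O(1)}{|x|+1}$. If the set $\{\lambda_j\}$ is countable, then for any function $C(x)>0$ on $(0,\infty)$ with $\lim_{x\to\infty}C(x)=\infty$ there exist potentials $q\in C^\infty(-\infty,\infty)$ such that (1) for each $j$, the equation $(-D^2+q)u=\lambda_j u$ has a nontrivial solution $u\in L^2(\mathbb{R})$; (2) $|q(x)|\le\frac{C(|x|)}{|x|+1}$ for all $x\in\mathbb{R}\setminus\{0\}$.
   Context: $D=\frac{d}{dx}$, and potentials are real-valued. *)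

(* Defs.v *)
From HB Require Import structures.
From mathcomp Require Import all_boot all_order all_algebra.
From mathcomp Require Import all_classical all_reals all_analysis.
Set Implicit Arguments.
Unset Strict Implicit.
Unset Printing Implicit Defensive.
Import Order.TTheory GRing.Theory Num.Theory.
Import numFieldNormedType.Exports.
Local Open Scope classical_set_scope.
Local Open Scope ring_scope.

(* [derive1n] is total, so the existence of every derivative has to be
   required explicitly. *)
Definition smooth (R : realType) (f : R -> R) : Prop :=
  forall (n : nat) (x : R), derivable (f^`(n)%classic) x 1.

(* Classical solutions of (- D^2 + q) u = l u on the whole line.  Since q and l
   are real, the real and imaginary parts of a complex-valued solution are
   solutions too, so real-valued u suffice. *)
Definition schrodinger_solution (R : realType) (q : R -> R) (l : R)
    (u : R -> R) : Prop :=
  [/\ forall x, derivable u x 1,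
      forall x, derivable (u^`()%classic) x 1
    & forall x, - (u^`(2)%classic) x + q x * u x = l * u x].

Definition has_L2_solution (R : realType) (q : R -> R) (l : R) : Prop :=
  exists u : R -> R,
    [/\ schrodinger_solution q l u,
        exists x, u x != 0
      & u \in Lfun (@lebesgue_measure R) 2%:E].

(* Main.v *)
Require Import Defs.
From HB Require Import structures.
From mathcomp Require Import all_boot all_order all_algebra.
From mathcomp Require Import all_classical all_reals all_analysis.
From mathcomp Require Import measurable_realfun.
From mathcomp Require Import ring lra.
Set Implicit Arguments.
Unset Strict Implicit.
Unset Printing Implicit Defensive.
Import Order.TTheory GRing.Theory Num.Theory.
Import numFieldNormedType.Exports.
Local Open Scope classical_set_scope.
Local Open Scope ring_scope.

(** The potential is even and vanishes near 0; it is built on the dyadic intervals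
    [[2^s, 2^(s+1)]].  At stage s finitely many energies k^2 are active and the
    interval is divided into one subinterval of length L ~ 2^s / n for each of them.
    If S solves S'' = - k^2 S, then [u = exp (- F) S] with F' = w S^2 + O(1/L^2) and
    w = O(1/L) solves u'' = (q - k^2) u for an explicit smooth
    q = - 2 w (S^2)' + O(1/L^2) supported in the subinterval, so that the phase of S
    can be matched to the solution already constructed, whose amplitude then shrinks
    by e^(-2).  At any other energy, q is an O(1/L) non-resonant oscillation: adding
    an O(1/L) quadratic correction to u'^2 + l u^2 makes its derivative O(1/L^2), and
    the amplitude changes by a factor 1 + O(1/L) only.  Hence u'^2 + k^2 u^2 is
    divided by at least 4 on every dyadic interval on which k^2 is active, and u is
    O(1/x).  Energies are activated one by one, as late as the constants in |q| <= K/x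
    and the function C require. *)

(** * Derivatives and smooth functions *)

(** For each energy only one solution is followed, the one equal to [cos (k * x)] for [x <= 1]. Its
    phase at the left end of a bump is dictated by the potential built so far, so the construction
    is a plain recursion; and since this solution is even near 0, it reflects to a solution for the
    even potential. The size 1/x is the natural scale: over a length of about [2 ^ s], a potential
    of size [K / 2 ^ s] acts with total strength O(1), enough to multiply an amplitude by a fixed
    factor, and a fixed factor per doubling is a power of x. An active energy meets one resonant
    bump, worth e^(-4) for u'^2 + k^2 u^2, while the other bumps of the interval cost together at
    most a factor e. What remains is e^(-3) <= 1/4. The obstacle is that a bump made for one energy
    perturbs all the others, and the gaps l - k^2 have no lower bound. The gaps decide only how long
    a bump must be, hence how late an energy can be activated. The constant K grows with the number
    of active energies, which is why the infinite case has a function C in place of a constant. *)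

Section Derivatives.
Variable R : realType.
Implicit Types (f g df dg : R -> R) (a b c x y : R) (n : nat).

Definition has_deriv f df := forall x, is_derive x 1 f (df x).

Lemma der_id x : is_derive x 1 (fun y : R => y) 1.
Proof. exact: is_derive_id. Qed.

Lemma der_cst c x : is_derive x 1 (fun _ : R => c) 0.
Proof. exact: is_derive_cst. Qed.

Lemma derD f g a b x : is_derive x 1 f a -> is_derive x 1 g b ->
  is_derive x 1 (fun y => f y + g y) (a + b).
Proof. by move=> ? ?; exact: is_deriveD. Qed.

Lemma derN f a x : is_derive x 1 f a -> is_derive x 1 (fun y => - f y) (- a).
Proof. by move=> ?; exact: is_deriveN. Qed.

Lemma derM f g a b x : is_derive x 1 f a -> is_derive x 1 g b ->
  is_derive x 1 (fun y => f y * g y) (a * g x + f x * b).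
Proof.
move=> fa gb; have := is_deriveM fa gb; rewrite addrC.
by rewrite /GRing.scale/= (mulrC (g x)).
Qed.

Lemma derX f a n x : is_derive x 1 f a ->
  is_derive x 1 (fun y => f y ^+ n) (n%:R * f x ^+ n.-1 * a).
Proof.
move=> fa; elim: n => [|n IH].
  by rewrite !mul0r; under eq_fun do rewrite expr0; exact: der_cst.
under eq_fun do rewrite exprS; eapply is_derive_eq; first exact: derM fa IH.
rewrite /= -natr1; case: n {IH} => [|n] /=; first by rewrite expr0; ring.
by rewrite exprS; ring.
Qed.

Lemma der_comp f df g b x : has_deriv f df -> is_derive x 1 g b ->
  is_derive x 1 (fun y => f (g y)) (df (g x) * b).
Proof. by move=> fd gb; exact: is_derive1_comp. Qed.

Lemma der_expR f a x : is_derive x 1 f a ->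
  is_derive x 1 (fun y => expR (f y)) (expR (f x) * a).
Proof. by move=> fa; apply: (@der_comp expR expR) fa => y; exact: is_derive_expR. Qed.

Lemma der_sin f a x : is_derive x 1 f a ->
  is_derive x 1 (fun y => sin (f y)) (cos (f x) * a).
Proof. by move=> fa; apply: (@der_comp sin cos) fa => y; exact: is_derive_sin. Qed.

Lemma der_cos f a x : is_derive x 1 f a ->
  is_derive x 1 (fun y => cos (f y)) (- sin (f x) * a).
Proof.
by move=> fa; apply: (@der_comp cos (fun y => - sin y)) fa => y; exact: is_derive_cos.
Qed.

Lemma derV f a x : f x != 0 -> is_derive x 1 f a ->
  is_derive x 1 (fun y => (f y)^-1) (- (f x) ^- 2 * a).
Proof. by move=> fx fa; exact: is_deriveV. Qed.

End Derivatives.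

Ltac der_step := first
  [ match goal with
    | H : has_deriv ?f _ |- is_derive _ _ ?f _ => eapply H
    | H : has_deriv ?f _ |- is_derive _ _ (fun y => ?f y) _ => eapply H
    | H : has_deriv ?f _ |- is_derive _ _ (fun y => ?f (@?g y)) _ =>
        eapply (der_comp H)
    end
  | eapply der_id | eapply der_cst | eapply derN | eapply derD
  | eapply derM | eapply derX | eapply der_expR | eapply der_sin
  | eapply der_cos ].

Ltac der := eapply is_derive_eq; [repeat der_step | rewrite /=].

(** * Monotonicity, boundedness on segments and Gronwall's inequality *)

Section HasDeriv.
Variable R : realType.
Implicit Types (f g df dg : R -> R) (a b c x y M : R).

Lemma has_deriv_derivable f df x : has_deriv f df -> derivable f x 1.
Proof. by move=> /(_ x)[]. Qed.

Lemma has_derivE f df : has_deriv f df -> f^`()%classic = df.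
Proof. by move=> fd; apply/funext => x; rewrite derive1E; case: (fd x). Qed.

Lemma derivable_has_deriv f : (forall x, derivable f x 1) ->
  has_deriv f f^`()%classic.
Proof. by move=> fd x; apply: DeriveDef => //; rewrite derive1E. Qed.

Lemma has_deriv_continuous f df : has_deriv f df -> continuous f.
Proof.
by move=> fd x; apply: differentiable_continuous; apply/derivable1_diffP; case: (fd x).
Qed.

Lemma has_deriv_within f df a b : has_deriv f df -> {within `[a, b], continuous f}.
Proof. by move=> /has_deriv_continuous cf; apply: continuous_subspaceT. Qed.

Lemma has_deriv_le f df a b : has_deriv f df -> a <= b ->
  (forall x, a <= x <= b -> 0 <= df x) -> f a <= f b.
Proof.
move=> fd ab df0; have [||c] := @MVT_segment R f df a b ab.
- by move=> x _; exact: fd.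
- exact: has_deriv_within.
rewrite in_itv/= => cab fE; rewrite -subr_ge0 fE mulr_ge0 ?df0//.
by rewrite subr_ge0.
Qed.

Lemma bounded_on_segment f a b : continuous f ->
  exists2 M, 0 < M & forall x, a <= x <= b -> `|f x| <= M.
Proof.
move=> cf; have [ab|ba] := leP a b; last first.
  by exists 1 => // x /andP[ax xb]; have := le_trans ax xb; rewrite leNgt ba.
have cn : {within `[a, b], continuous (fun x => `|f x|)}.
  apply: continuous_subspaceT => x.
  by apply: continuous_comp; [exact: cf|exact: norm_continuous].
have [c _ cM] := EVT_max ab cn.
exists (`|f c| + 1) => [|x xab]; first by rewrite ltr_wpDl.
by rewrite (le_trans (cM x _)) ?lerDl// in_itv/=.
Qed.

(** The product of [f y] with [expR (- (M * (y - a)))] has nonpositive derivative, so it does not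
    exceed its value at [a]. *)
Lemma gronwall f df M a b : has_deriv f df ->
  (forall x, a <= x <= b -> df x <= M * f x) ->
  forall x, a <= x <= b -> f x <= f a * expR (M * (x - a)).
Proof.
move=> fd dfM x /andP[ax xb].
pose g y := - (f y * expR (- (M * (y - a)))).
have gd : has_deriv g (fun y => (M * f y - df y) * expR (- (M * (y - a)))).
  by move=> y; rewrite /g; der; ring.
have := has_deriv_le gd ax; rewrite /g subrr mulr0 oppr0 expR0 mulr1 lerN2.
move=> H; have {}H : f x * expR (- (M * (x - a))) <= f a.
  apply: H => y /andP[ay yx]; rewrite mulr_ge0 ?expR_ge0// subr_ge0 dfM// ay.
  exact: le_trans xb.
by rewrite -ler_pdivrMr ?expR_gt0// -expRN.
Qed.

End HasDeriv.

(** * Closure properties and locality of smoothness *)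

Section Smoothness.
Variable R : realType.
Implicit Types (f g df dg : R -> R) (a b c x y : R) (n : nat).

(** Iterated derivatives of a product or a composite have no convenient closed form. Recursion on
    the first derivative makes every closure property an induction on [n] in which only the product
    and chain rules appear. *)
Fixpoint smoothn n f : Prop :=
  (forall x, derivable f x 1) /\
  (if n is m.+1 then smoothn m f^`()%classic else True).

Lemma smoothnP f : (forall n, smoothn n f) <-> smooth f.
Proof.
split=> [fs n x|+ n].
  elim: n f {fs}(fs n) x => [|n IH] f [fd fn] x; first exact: fd.
  by rewrite /derive1n iterSr; apply: IH.
elim: n f => [|n IH] f fs /=; split=> //; try by move=> x; exact: (fs 0%N).
by apply: IH => m x; have := fs m.+1 x; rewrite /derive1n iterSr.
Qed.

Lemma smoothn_derivable n f x : smoothn n f -> derivable f x 1.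
Proof. by case: n => [|n] /= [+ _]; apply. Qed.

Lemma smoothnW n f : smoothn n.+1 f -> smoothn n f.
Proof. by elim: n f => [|n IH] f /= [? ?]; split=> //; exact: IH. Qed.

Lemma smoothn_has_deriv n f df : has_deriv f df -> smoothn n df -> smoothn n.+1 f.
Proof.
move=> fd dfs /=; split=> [x|]; first exact: has_deriv_derivable fd.
by rewrite (has_derivE fd).
Qed.

Lemma smoothn0 f df : has_deriv f df -> smoothn 0 f.
Proof. by move=> fd /=; split=> // x; exact: has_deriv_derivable fd. Qed.

Lemma smoothn_deriv n f : smoothn n f -> has_deriv f f^`()%classic.
Proof. by move=> fs; apply: derivable_has_deriv => x; exact: smoothn_derivable fs. Qed.

Lemma smoothn_cst n c : smoothn n (fun _ : R => c).
Proof.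
have cd c' : has_deriv (fun _ : R => c') (fun _ => 0) by move=> x; exact: der_cst.
by elim: n c => [|n IH] c; [apply: smoothn0|apply: (smoothn_has_deriv (cd c))].
Qed.

Lemma smoothnD n f g : smoothn n f -> smoothn n g -> smoothn n (fun x => f x + g x).
Proof.
elim: n f g => [|n IH] f g fs gs;
  have fgd : has_deriv (fun x => f x + g x)
    (fun x => f^`()%classic x + g^`()%classic x)
    by move=> x; apply: derD; [exact: smoothn_deriv fs _|exact: smoothn_deriv gs _].
- exact: smoothn0 fgd.
- by apply: (smoothn_has_deriv fgd); apply: IH; [case: fs|case: gs].
Qed.

Lemma smoothnM n f g : smoothn n f -> smoothn n g -> smoothn n (fun x => f x * g x).
Proof.
elim: n f g => [|n IH] f g fs gs;
  have fgd : has_deriv (fun x => f x * g x)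
    (fun x => f^`()%classic x * g x + f x * g^`()%classic x)
    by move=> x; apply: derM; [exact: smoothn_deriv fs _|exact: smoothn_deriv gs _].
- exact: smoothn0 fgd.
- apply: (smoothn_has_deriv fgd); apply: smoothnD; apply: IH => //.
  + by case: fs.
  + exact: smoothnW.
  + exact: smoothnW.
  + by case: gs.
Qed.

Lemma smoothn_comp n f g : smoothn n f -> smoothn n g -> smoothn n (fun x => f (g x)).
Proof.
elim: n f g => [|n IH] f g fs gs;
  have fgd : has_deriv (fun x => f (g x))
    (fun x => f^`()%classic (g x) * g^`()%classic x)
    by move=> x; apply: der_comp; [exact: smoothn_deriv fs|exact: smoothn_deriv gs _].
- exact: smoothn0 fgd.
- apply: (smoothn_has_deriv fgd); apply: smoothnM; last by case: gs.
  by apply: IH; [case: fs|exact: smoothnW].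
Qed.

Lemma smoothnV n f : (forall x, f x != 0) -> smoothn n f -> smoothn n (fun x => (f x)^-1).
Proof.
move=> f0; elim: n => [|n IH] fs;
  have fd : has_deriv (fun x => (f x)^-1)
    (fun x => (- 1) * ((f x)^-1 * (f x)^-1) * f^`()%classic x).
- move=> x; have := derV (f0 x) (smoothn_deriv fs x).
  by rewrite -exprVn expr2 mulN1r.
- exact: smoothn0 fd.
- move=> x; have := derV (f0 x) (smoothn_deriv fs x).
  by rewrite -exprVn expr2 mulN1r.
- have IH' := IH (smoothnW fs).
  apply: (smoothn_has_deriv fd); apply: smoothnM; last by case: fs.
  by apply: smoothnM; [exact: smoothn_cst|exact: smoothnM].
Qed.

Lemma smooth_cst c : smooth (fun _ : R => c).
Proof. by apply/smoothnP => n; exact: smoothn_cst. Qed.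

Lemma smoothD f g : smooth f -> smooth g -> smooth (fun x => f x + g x).
Proof. by move=> /smoothnP fs /smoothnP gs; apply/smoothnP => n; exact: smoothnD. Qed.

Lemma smoothM f g : smooth f -> smooth g -> smooth (fun x => f x * g x).
Proof. by move=> /smoothnP fs /smoothnP gs; apply/smoothnP => n; exact: smoothnM. Qed.

Lemma smoothN f : smooth f -> smooth (fun x => - f x).
Proof.
move=> fs; under eq_fun do rewrite -mulN1r.
by apply: smoothM => //; exact: smooth_cst.
Qed.

Lemma smoothX f n : smooth f -> smooth (fun x => f x ^+ n).
Proof.
move=> fs; elim: n => [|n IH]; first by under eq_fun do rewrite expr0; exact: smooth_cst.
by under eq_fun do rewrite exprS; exact: smoothM.
Qed.

Lemma smoothV f : (forall x, f x != 0) -> smooth f -> smooth (fun x => (f x)^-1).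
Proof. by move=> f0 /smoothnP fs; apply/smoothnP => n; exact: smoothnV. Qed.

Lemma smooth_comp f g : smooth f -> smooth g -> smooth (fun x => f (g x)).
Proof. by move=> /smoothnP fs /smoothnP gs; apply/smoothnP => n; exact: smoothn_comp. Qed.

Lemma smooth_id : smooth (fun x : R => x).
Proof.
have id_deriv : has_deriv (fun x : R => x) (fun _ => 1) by move=> x; exact: der_id.
apply/smoothnP => -[|n]; first exact: smoothn0 id_deriv.
by apply: (smoothn_has_deriv id_deriv); exact: smoothn_cst.
Qed.

Lemma smooth_sin_cos : smooth (@sin R) /\ smooth (@cos R).
Proof.
have sin_deriv : has_deriv (@sin R) cos by move=> x; exact: is_derive_sin.
have cos_deriv : has_deriv (@cos R) (fun x => (- 1) * sin x).
  by move=> x; rewrite mulN1r; exact: is_derive_cos.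
suff sc n : smoothn n (@sin R) /\ smoothn n (@cos R).
  by split; apply/smoothnP => n; case: (sc n).
elim: n => [|n [sn cs]].
  by split; [exact: smoothn0 sin_deriv|exact: smoothn0 cos_deriv].
split; first exact: smoothn_has_deriv sin_deriv cs.
apply: smoothn_has_deriv cos_deriv _; apply: smoothnM => //; exact: smoothn_cst.
Qed.

Lemma smooth_deriv f : smooth f -> has_deriv f f^`()%classic.
Proof. by move=> fs; apply: derivable_has_deriv => x; exact: (fs 0%N). Qed.

Lemma smooth_derive1 f : smooth f -> smooth f^`()%classic.
Proof. by move=> fs n x; have := fs n.+1 x; rewrite /derive1n iterSr. Qed.

Lemma near_eq_derive1 f g x : (\near x, f x = g x) ->
  \near x, f^`()%classic x = g^`()%classic x.
Proof.
move=> /nbhs_interior; apply: filterS => y /= fg.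
by rewrite !derive1E; exact: near_eq_derive.
Qed.

Lemma near_eq_derive1n f g n x : (\near x, f x = g x) ->
  \near x, (f^`(n))%classic x = (g^`(n))%classic x.
Proof. by elim: n => // n IH fg; rewrite !derive1nS; apply/near_eq_derive1/IH. Qed.

(** Needed for the half-line potential, which near each point coincides with some finite stage of
    the recursion. *)
Lemma smooth_local f : (forall x, exists2 g, smooth g & \near x, g x = f x) -> smooth f.
Proof.
move=> floc n x; have [g gs gf] := floc x.
apply: near_eq_derivable (gs n x); last exact: near_eq_derive1n.
Qed.

End Smoothness.

(** * A smooth cutoff *)

Section SmoothStep.
Variable R : realType.
Implicit Types (x y : R) (n : nat).

(** The classical flat function is the case [n = 0]. The powers of [x^-1] are included so that the
    family is stable under differentiation up to linear combinations, as [flat_deriv] shows. *)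
Definition flat n x : R := if 0 < x then x^-1 ^+ n * expR (- x^-1) else 0.

Lemma flat_le0 n x : x <= 0 -> flat n x = 0.
Proof. by rewrite /flat ltNge => ->. Qed.

Lemma flat_ge0 n x : 0 <= flat n x.
Proof.
rewrite /flat; case: ifP => // x0.
by rewrite mulr_ge0 ?expR_ge0// exprn_ge0// invr_ge0 ltW.
Qed.

(** With y = 1/x this is y^(n+2) / (n+2)! <= e^y. The square of [x] makes the difference quotient at
    0 tend to 0. *)
Lemma flat_bound n x : flat n x <= n.+2`!%:R * x ^+ 2.
Proof.
have [x0|x0] := leP x 0.
  by rewrite flat_le0// mulr_ge0 ?sqr_ge0.
have y0 : 0 < x^-1 by rewrite invr_gt0.
have fact0 : 0 < n.+2`!%:R :> R by rewrite ltr0n fact_gt0.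
rewrite /flat x0 expRN ler_pdivrMr ?expR_gt0//.
have := expR_ge1Dxn n.+1 (ltW y0).
move=> /(le_trans (ler_wpDl ler01 (lexx _))).
rewrite ler_pdivrMr// => le_exp.
rewrite -(ler_pM2l (exprn_gt0 2 y0)) -exprD add2n (le_trans le_exp)//.
by rewrite exprVn [leRHS](_ : _ = expR x^-1 * n.+2`!%:R)//; field; rewrite gt_eqF.
Qed.

Lemma flat_deriv n :
  has_deriv (flat n) (fun x => - n%:R * flat n.+1 x + flat n.+2 x).
Proof.
move=> x; have [x0|x0|->] := ltgtP x 0.
- rewrite !flat_le0 ?ltW// mulr0 addr0.
  apply: near_eq_is_derive (der_cst 0 x).
  by near=> y; rewrite flat_le0// ltW//; near: y; exact: lt_nbhsl.
- apply: (@near_eq_is_derive _ _ _ (fun y => y^-1 ^+ n * expR (- y^-1))).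
    near=> y; rewrite /flat ifT//; near: y; exact: lt_nbhsr.
  have x_neq0 : x != 0 by rewrite gt_eqF.
  eapply is_derive_eq.
    eapply derM; [eapply derX|eapply der_expR; eapply derN];
      (eapply derV; [exact: x_neq0|exact: der_id]).
  rewrite /flat x0 /=; case: n => [|n] /=; rewrite ?expr0 ?exprS; by field.
- rewrite !flat_le0// mulr0 addr0.
  have flatV h : `|h^-1 * flat n h| <= n.+2`!%:R * `|h|.
    have [->|h0] := eqVneq h 0; first by rewrite invr0 mul0r normr0 mulr0.
    rewrite normrM normfV ler_pdivrMl ?normr_gt0// ger0_norm ?flat_ge0//.
    by rewrite (le_trans (flat_bound _ _))// [leRHS]mulrCA -expr2 real_normK// num_real.
  have flim : h^-1 *: (flat n (h *: 1 + 0) - flat n 0) @[h --> 0^'] --> (0 : R).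
    apply/cvgrPdist_le => e e0; near=> h.
    rewrite sub0r normrN (flat_le0 _ (lexx 0)) subr0 addr0 /GRing.scale/= mulr1.
    rewrite (le_trans (flatV h))// -ler_pdivlMl ?ltr0n ?fact_gt0//.
    near: h; apply: dnbhs0_le; by rewrite mulr_gt0// invr_gt0 ltr0n fact_gt0.
  by apply: DeriveDef; [apply/cvg_ex; exists 0; exact: flim|exact: (cvg_lim _ flim)].
Unshelve. all: by end_near. Qed.

Lemma smooth_flat n : smooth (flat n).
Proof.
apply/smoothnP => m; elim: m n => [|m IH] n; first exact: smoothn0 (flat_deriv n).
apply: (smoothn_has_deriv (flat_deriv n)); apply: smoothnD => //.
by apply: smoothnM => //; exact: smoothn_cst.
Qed.

Definition step x : R := flat 0 x / (flat 0 x + flat 0 (1 - x)).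

Lemma step_denom_gt0 x : 0 < flat 0 x + flat 0 (1 - x).
Proof.
have flat_gt0 y : 0 < y -> 0 < flat 0 y by move=> y0; rewrite /flat y0 mul1r expR_gt0.
have [x0|x0] := ltP 0 x; first by rewrite ltr_pwDl ?flat_ge0// flat_gt0.
by rewrite ltr_wpDl ?flat_ge0// flat_gt0// subr_gt0 (le_lt_trans x0).
Qed.

Lemma smooth_step : smooth step.
Proof.
apply: smoothM; first exact: smooth_flat.
apply: smoothV => [x|]; first by rewrite gt_eqF// step_denom_gt0.
apply: smoothD; first exact: smooth_flat.
apply: smooth_comp; first exact: smooth_flat.
by apply: smoothD; [exact: smooth_cst|apply: smoothN; exact: smooth_id].
Qed.

Lemma step_le0 x : x <= 0 -> step x = 0.
Proof. by move=> x0; rewrite /step (flat_le0 _ x0) mul0r. Qed.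

Lemma step_ge1 x : 1 <= x -> step x = 1.
Proof.
move=> x1; have := step_denom_gt0 x.
rewrite /step (@flat_le0 _ (1 - x)) ?subr_le0// addr0 => x0.
by rewrite divff// gt_eqF.
Qed.

Lemma step_ge0 x : 0 <= step x.
Proof. by rewrite /step divr_ge0 ?flat_ge0// ltW// step_denom_gt0. Qed.

Lemma derive1n_cst (a : R) n : ((fun _ : R => a)^`(n.+1))%classic = fun _ => 0.
Proof.
elim: n a => [|n IH] a; first by rewrite derive1n1; apply: has_derivE => x; exact: der_cst.
by rewrite derive1nS IH; apply: has_derivE => x; exact: der_cst.
Qed.

(* The factor 3 makes [cutoff] locally constant at 0 and at 1. *)
Definition cutoff x : R := step (3 * x - 1).

Lemma smooth_cutoff : smooth cutoff.
Proof.
apply: smooth_comp smooth_step _; apply: smoothD; last exact: smooth_cst.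
by apply: smoothM; [exact: smooth_cst|exact: smooth_id].
Qed.

Lemma cutoff_ge0 x : 0 <= cutoff x.
Proof. exact: step_ge0. Qed.

Lemma cutoff0 : cutoff 0 = 0.
Proof. by rewrite /cutoff step_le0//; lra. Qed.

Lemma cutoff1 : cutoff 1 = 1.
Proof. by rewrite /cutoff step_ge1//; lra. Qed.

Lemma cutoff_derive_out n x : x <= 0 \/ 1 <= x -> (cutoff^`(n.+1))%classic x = 0.
Proof.
move=> x01; suff [a xa] : exists a, \near x, cutoff x = a.
  have /nbhs_singleton -> := near_eq_derive1n n.+1 xa.
  by rewrite derive1n_cst.
have [x0|x1] : x < 1 / 3 \/ 2 / 3 < x by case: x01 => ?; [left|right]; lra.
- exists 0; near=> y; rewrite /cutoff step_le0//.
  have : y < 1 / 3 by near: y; exact: lt_nbhsl.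
  by lra.
- exists 1; near=> y; rewrite /cutoff step_ge1//.
  have : 2 / 3 < y by near: y; exact: lt_nbhsr.
  by lra.
Unshelve. all: by end_near. Qed.

Lemma cutoff_derive_bound n : exists2 M, 0 < M &
  forall x, `|(cutoff^`(n.+1))%classic x| <= M.
Proof.
have [|M M0 bM] := @bounded_on_segment _ (cutoff^`(n.+1))%classic 0 1.
  apply: (@has_deriv_continuous _ _ (cutoff^`(n.+2))%classic).
  by rewrite [X in has_deriv _ X]derive1nS; apply: derivable_has_deriv => x; exact: smooth_cutoff.
exists M => // x; have [x0|x0] := ltP x 0.
  by rewrite cutoff_derive_out ?normr0 ?(ltW M0)//; left; exact: ltW.
have [x1|x1] := ltP 1 x.
  by rewrite cutoff_derive_out ?normr0 ?(ltW M0)//; right; exact: ltW.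
by rewrite bM// x0.
Qed.

End SmoothStep.

(** * Uniqueness and existence of solutions *)

Section Solutions.
Variable R : realType.
Implicit Types (q u du v dv f g : R -> R) (a b c k l x y M : R) (n : nat).

Definition is_sol q l u du :=
  has_deriv u du /\ has_deriv du (fun x => (q x - l) * u x).

(** Gronwall applied to z^2 + z'^2, where z is the difference of the solutions: its derivative is 2
    z z' (1 + q - l), and |2 z z'| <= z^2 + z'^2, whence the rate [1 + M + |l|]. *)
Lemma is_sol_eq q1 q2 l u du v dv a b : continuous q1 ->
  is_sol q1 l u du -> is_sol q2 l v dv ->
  (forall x, a <= x <= b -> q1 x = q2 x) -> u a = v a -> du a = dv a ->
  forall x, a <= x <= b -> u x = v x /\ du x = dv x.
Proof.
move=> cq [u1 u2] [v1 v2] q12 uv duv x xab.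
have [M M0 qM] := bounded_on_segment a b cq.
pose E x := (u x - v x) ^+ 2 + (du x - dv x) ^+ 2.
have Ed : has_deriv E (fun x => 2 * (u x - v x) * (du x - dv x) +
    2 * (du x - dv x) * ((q1 x - l) * u x - (q2 x - l) * v x)).
  by move=> y; rewrite /E; der; ring.
have := gronwall (M := 1 + M + `|l|) Ed _ xab.
rewrite /E uv duv !subrr expr0n/= addr0 mul0r => H.
have {}H : (u x - v x) ^+ 2 + (du x - dv x) ^+ 2 <= 0.
  apply: H => y yab; rewrite -(q12 _ yab) -mulrBr.
  move: (u y - v y) (du y - dv y) => z dz.
  have -> : 2 * z * dz + 2 * dz * ((q1 y - l) * z) = 2 * z * dz * (1 + q1 y - l) by ring.
  have zdz : `|2 * z * dz| <= z ^+ 2 + dz ^+ 2.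
    rewrite ler_norml; have := sqr_ge0 (z + dz); have := sqr_ge0 (z - dz).
    have -> : (z - dz) ^+ 2 = z ^+ 2 + dz ^+ 2 - 2 * z * dz by ring.
    have -> : (z + dz) ^+ 2 = z ^+ 2 + dz ^+ 2 + 2 * z * dz by ring.
    move: (2 * z * dz) (z ^+ 2 + dz ^+ 2) => s t; lra.
  have qM' : `|1 + q1 y - l| <= 1 + M + `|l|.
    rewrite (le_trans (ler_normB _ _))// lerD2r (le_trans (ler_normD _ _))//.
    by rewrite normr1 lerD2l qM.
  by rewrite (le_trans (ler_norm _))// normrM mulrC ler_pM.
have [z0 dz0] : (u x - v x) ^+ 2 = 0 /\ (du x - dv x) ^+ 2 = 0.
  have := sqr_ge0 (u x - v x); have := sqr_ge0 (du x - dv x).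
  by move: (_ ^+ 2) (_ ^+ 2) H => s t; lra.
by split; apply/eqP; rewrite -subr_eq0 -sqrf_eq0; apply/eqP.
Qed.

(** For negative [x] the segment [[0, x]] is empty and the integral is 0. This is still an
    antiderivative on the whole line because [f] vanishes left of 1. *)
Lemma antiderivative f : continuous f -> (forall x, x <= 1 -> f x = 0) ->
  exists2 F, has_deriv F f & forall x, x <= 1 -> F x = 0.
Proof.
move=> cf f0; pose F x := \int[@lebesgue_measure R]_(t in `[0, x]) f t.
have F0 x : x <= 1 -> F x = 0.
  move=> x1; rewrite /F (@eq_Rintegral _ _ _ _ _ (cst 0)) => [|t].
    by rewrite /Rintegral integral0.
  by rewrite inE/= in_itv/= => /andP[_ tx]; rewrite f0// (le_trans tx).
exists F => // x; have [x1|x1] := ltP x 1.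
  rewrite f0 ?ltW//; apply: near_eq_is_derive (der_cst 0 x).
  by near=> y; rewrite F0// ltW//; near: y; exact: lt_nbhsl.
have intf : (@lebesgue_measure R).-integrable `[0, x + 1] (EFin \o f).
  apply: continuous_compact_integrable; first exact: segment_compact.
  exact: continuous_subspaceT.
have xx1 : x < x + 1 by rewrite ltrDl.
have [dF FE] := continuous_FTC1_closed xx1 intf (lt_le_trans ltr01 x1) (@cf x).
by rewrite derive1E in FE; exact: DeriveDef dF FE.
Unshelve. all: by end_near. Qed.

(** The intervals with centre [a n] and radius [2 * c * 2^-1 ^+ n] are nested; the limit is the
    supremum of their left ends [b n]. *)
Lemma geometric_limit (a : nat -> R) c :
  (forall n, `|a n.+1 - a n| <= c * 2^-1 ^+ n) ->
  exists l, forall n, `|l - a n| <= 2 * c * 2^-1 ^+ n.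
Proof.
move=> ac; pose b n := a n - 2 * c * 2^-1 ^+ n; pose d n := a n + 2 * c * 2^-1 ^+ n.
have half n : 2^-1 ^+ n.+1 = 2^-1 * 2^-1 ^+ n :> R by rewrite exprS.
have c0 : 0 <= c by have := ac 0%N; rewrite mulr1; apply: le_trans.
have p0 n : 0 <= c * 2^-1 ^+ n by rewrite mulr_ge0// exprn_ge0.
have bnd n m : (n <= m)%N -> b n <= b m.
  elim: m => [|m IH]; first by rewrite leqn0 => /eqP->.
  rewrite leq_eqVlt => /predU1P[->//|/IH bm]; apply: (le_trans bm).
  by have := ac m; rewrite /b half ler_norml; lra.
have dni n m : (n <= m)%N -> d m <= d n.
  elim: m => [|m IH]; first by rewrite leqn0 => /eqP->.
  rewrite leq_eqVlt => /predU1P[->//|/IH bm]; apply: le_trans bm.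
  by have := ac m; rewrite /d half ler_norml; lra.
have bd n m : b n <= d m.
  rewrite (le_trans (bnd _ (maxn n m) (leq_maxl _ _)))//.
  rewrite (le_trans _ (dni _ (maxn n m) (leq_maxr _ _)))//.
  by rewrite /b /d; have := p0 (maxn n m); lra.
exists (sup (range b)) => n.
have Sb : has_ubound (range b) by exists (d 0%N) => _ [m _ <-].
have S1 : b n <= sup (range b) by apply: ub_le_sup => //; exists n.
have S2 : sup (range b) <= d n.
  by apply: ge_sup; [exists (b 0%N); exists 0%N|move=> _ [m _ <-]].
by move: S1 S2; rewrite /b /d ler_norml; lra.
Qed.

(** * Global existence by Picard iteration *)

Section Picard.
Variables (q : R -> R) (k M : R).
Hypotheses (k_gt0 : 0 < k) (M_ge0 : 0 <= M) (q_cont : continuous q)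
  (q_le1 : forall x, x <= 1 -> q x = 0) (q_bound : forall x, `|q x| <= M).

(* Variation of constants for u'' + k^2 u = q u. *)
Definition picard_step f g := exists A B : R -> R,
  [/\ has_deriv A (fun x => - (q x / k * sin (k * x) * f x)),
      has_deriv B (fun x => q x / k * cos (k * x) * f x),
      forall x, x <= 1 -> A x = 0 /\ B x = 0 &
      g = fun x => cos (k * x) * (1 + A x) + sin (k * x) * B x].

(** Rate of the weight e^(L|x|) that makes the Picard map a contraction on the whole line at once.
    With this value each of the two integrals [A] and [B] contributes a factor 1/4, so the map
    contracts by 1/2. *)
Let L := 4 * M / k.

Let L_ge0 : 0 <= L. Proof. by rewrite !mulr_ge0// invr_ge0 ltW. Qed.

Let trig_cont : continuous (fun x => sin (k * x)) /\ continuous (fun x => cos (k * x)).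
Proof.
split.
- apply: (@has_deriv_continuous _ _ (fun x => k * cos (k * x))) => x.
  by der; ring.
- apply: (@has_deriv_continuous _ _ (fun x => - k * sin (k * x))) => x.
  by der; ring.
Qed.

Lemma picard_step_total f : continuous f -> exists g, picard_step f g.
Proof.
move=> cf; have [cs cc] := trig_cont.
have [||A Ad A0] := @antiderivative (fun x => - (q x / k * sin (k * x) * f x)).
- move=> x; apply: cvgN; apply: cvgM; last exact: cf.
  by apply: cvgM; [apply: cvgM; [exact: q_cont|exact: cvg_cst]|exact: cs].
- by move=> x x1; rewrite q_le1// !mul0r oppr0.
have [||B Bd B0] := @antiderivative (fun x => q x / k * cos (k * x) * f x).
- move=> x; apply: cvgM; last exact: cf.
  by apply: cvgM; [apply: cvgM; [exact: q_cont|exact: cvg_cst]|exact: cc].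
- by move=> x x1; rewrite q_le1// !mul0r.
exists (fun x => cos (k * x) * (1 + A x) + sin (k * x) * B x), A, B.
by split=> // x x1;
  split; auto.
Qed.

Lemma picard_step_continuous f g : picard_step f g -> continuous g.
Proof.
move=> [A [B [Ad Bd _ ->]]].
eapply has_deriv_continuous => x; repeat der_step.
Qed.

(** The assumed bound on [h] is exactly the derivative of [c / 4 * expR (L * x)], so adding or
    subtracting [H] leaves a nondecreasing function on the half line. *)
Lemma antiderivative_contraction (h H : R -> R) c : 0 <= c -> has_deriv H h -> H 0 = 0 ->
  (forall x, `|h x| <= M / k * (c * expR (L * `|x|))) ->
  forall x, 0 <= x -> `|H x| <= c / 4 * expR (L * x).
Proof.
move=> c0 Hd H0 hc x x0.
have bnd y : 0 <= y -> `|h y| <= c / 4 * (L * expR (L * y)).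
  move=> y0; have := hc y; rewrite (ger0_norm y0) => /le_trans; apply.
  by rewrite le_eqVlt; apply/orP; left; apply/eqP; rewrite /L; field; rewrite gt_eqF.
have G1 : has_deriv (fun y => c / 4 * expR (L * y) - H y)
    (fun y => c / 4 * (L * expR (L * y)) - h y) by move=> y; der; ring.
have G2 : has_deriv (fun y => c / 4 * expR (L * y) + H y)
    (fun y => c / 4 * (L * expR (L * y)) + h y) by move=> y; der; ring.
have := has_deriv_le G1 x0; have := has_deriv_le G2 x0.
rewrite H0 mulr0 expR0 subr0 addr0 mulr1 ler_norml => H1 H2.
have {}H1 : c / 4 <= c / 4 * expR (L * x) + H x.
  by apply: H1 => y /andP[y0 _]; have := bnd y y0; rewrite ler_norml; lra.
have {}H2 : c / 4 <= c / 4 * expR (L * x) - H x.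
  by apply: H2 => y /andP[y0 _]; have := bnd y y0; rewrite ler_norml; lra.
by lra.
Qed.

Lemma picard_step_contraction f1 f2 g1 g2 c : 0 <= c ->
  picard_step f1 g1 -> picard_step f2 g2 ->
  (forall x, `|f1 x - f2 x| <= c * expR (L * `|x|)) ->
  forall x, `|g1 x - g2 x| <= c / 2 * expR (L * `|x|).
Proof.
move=> c0 [A1 [B1 [A1d B1d AB1 ->]]] [A2 [B2 [A2d B2d AB2 ->]]] fc x.
have [x0|x0] := ltP x 0.
  have x1 : x <= 1 by rewrite ltW// (lt_trans x0).
  have [-> ->] := AB1 _ x1; have [-> ->] := AB2 _ x1.
  by rewrite subrr normr0 mulr_ge0 ?expR_ge0// divr_ge0.
have sin_le1 y : `|sin y| <= 1 :> R by rewrite ler_norml sin_geN1 sin_le1.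
have cos_le1 y : `|cos y| <= 1 :> R by rewrite ler_norml cos_geN1 cos_le1.
have small (t : R) y : `|t| <= 1 ->
    `|q y / k * t * (f1 y - f2 y)| <= M / k * (c * expR (L * `|y|)).
  move=> t1; rewrite normrM ler_pM// normrM -[leRHS]mulr1 ler_pM//.
  by rewrite normrM normfV (gtr0_norm k_gt0) ler_pM2r ?invr_gt0.
have Ax : `|A1 x - A2 x| <= c / 4 * expR (L * x).
  have Ad : has_deriv (fun y => A1 y - A2 y)
      (fun y => - (q y / k * sin (k * y) * (f1 y - f2 y))) by move=> y; der; ring.
  apply: antiderivative_contraction c0 Ad _ _ _ x0.
    by rewrite (AB1 _ ler01).1 (AB2 _ ler01).1 subrr.
  by move=> y; rewrite normrN small.
have Bx : `|B1 x - B2 x| <= c / 4 * expR (L * x).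
  have Bd : has_deriv (fun y => B1 y - B2 y)
      (fun y => q y / k * cos (k * y) * (f1 y - f2 y)) by move=> y; der; ring.
  apply: antiderivative_contraction c0 Bd _ _ _ x0.
    by rewrite (AB1 _ ler01).2 (AB2 _ ler01).2 subrr.
  by move=> y; rewrite small.
rewrite [X in `|X|](_ : _ = cos (k * x) * (A1 x - A2 x) +
  sin (k * x) * (B1 x - B2 x)); last by ring.
rewrite (le_trans (ler_normD _ _))// !normrM (ger0_norm x0).
have -> : c / 2 * expR (L * x) = 1 * (c / 4 * expR (L * x)) + 1 * (c / 4 * expR (L * x)).
  by field.
by rewrite lerD// ler_pM.
Qed.

Lemma solution_exists : exists u du, is_sol q (k ^+ 2) u du /\
  forall x, x <= 1 -> u x = cos (k * x).
Proof.
have [T TP] : exists T : (R -> R) -> R -> R, forall f, continuous f -> picard_step f (T f).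
  (* Choice needs a total relation; a discontinuous [f] receives the junk value [f]. *)
  suff /choice[T TP] : forall f, exists g, continuous f -> picard_step f g by exists T.
  move=> f; have [cf|ncf] := pselect (continuous f); last by exists f.
  by have [g fg] := picard_step_total cf; exists g.
pose v n := iter n T (fun _ => 0).
have v_cont n : continuous (v n).
  elim: n => [|n IH]; first by move=> x; exact: cvg_cst.
  exact: picard_step_continuous (TP _ IH).
have v_step n : picard_step (v n) (v n.+1) by exact: TP.
have E1 x : 1 <= expR (L * `|x|) by rewrite -expR0 ler_expR mulr_ge0.
have v_diff n : forall x, `|v n.+1 x - v n x| <= 2^-1 ^+ n * (2 * expR (L * `|x|)).
  elim: n => [|n IH].
    case: (v_step 0%N) => A [B [Ad Bd AB ->]] x.
    have A0 y : A y = 0.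
      have := @is_derive_0_is_cst R A y 1; rewrite (AB _ (lexx _)).1; apply=> z.
      by have := Ad z; rewrite mulr0 oppr0.
    have B0 y : B y = 0.
      have := @is_derive_0_is_cst R B y 1; rewrite (AB _ (lexx _)).2; apply=> z.
      by have := Bd z; rewrite mulr0.
    rewrite A0 B0 subr0 addr0 mulr0 addr0 mulr1 mul1r ler_norml.
    by have := cos_geN1 (k * x); have := cos_le1 (k * x); have := E1 x; lra.
  move=> x; have c0 : 0 <= 2^-1 ^+ n * 2 :> R by rewrite mulr_ge0// exprn_ge0.
  rewrite exprS [leRHS](_ : _ = 2^-1 ^+ n * 2 / 2 * expR (L * `|x|)); last by field.
  apply: (picard_step_contraction c0 (v_step n.+1) (v_step n)) => y.
  by rewrite -mulrA.
have /choice[u uP] : forall x, exists l, forall n,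
    `|l - v n x| <= 2^-1 ^+ n * (4 * expR (L * `|x|)).
  move=> x; have [n|l lP] := @geometric_limit (v ^~ x) (2 * expR (L * `|x|)).
    by rewrite mulrC.
  by exists l => n; rewrite (le_trans (lP n))// le_eqVlt; apply/orP; left; apply/eqP; ring.
have half_lim c e : 0 < e -> 0 <= c -> exists n, 2^-1 ^+ n * c <= e.
  move=> e0 c0; have : 2^-1 ^+ n @[n --> \oo] --> (0 : R).
    by apply: cvg_expr; rewrite ger0_norm// invf_lt1// ltr1n.
  move=> /cvgrPdist_le /(_ (e / (c + 1))) []; first by rewrite divr_gt0// ltr_wpDl.
  move=> n _ /(_ n (leqnn n)); rewrite sub0r normrN ger0_norm ?exprn_ge0// => nc.
  exists n; rewrite (le_trans (ler_wpM2r c0 nc))// mulrAC ler_pdivrMr ?ltr_wpDl//.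
  by rewrite (ler_wpM2l (ltW e0))// lerDl.
(* Convergence is uniform on bounded sets: near [x] the weight is at most its value at [|x| + 1],
   and the usual three times e/3 argument applies. *)
have u_cont : continuous u.
  move=> x; apply/cvgrPdist_le => e e0.
  have [n nP] := half_lim (4 * expR (L * (`|x| + 1))) (e / 3)
    ltac:(by rewrite divr_gt0) ltac:(by rewrite mulr_ge0// expR_ge0).
  have near_u y : `|y| <= `|x| + 1 -> `|u y - v n y| <= e / 3.
    move=> yx; rewrite (le_trans (uP y n))// (le_trans _ nP)//.
    by rewrite ler_wpM2l ?exprn_ge0// ler_wpM2l// ler_expR ler_wpM2l.
  have /cvgrPdist_le /(_ (e / 3)) vn := v_cont n x.
  near=> y.
  have ux : `|u x - v n x| <= e / 3 by apply: near_u; rewrite lerDl.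
  have uy : `|u y - v n y| <= e / 3.
    apply: near_u; rewrite -[y](subrK x) (le_trans (ler_normD _ _))// addrC lerD2l distrC.
    by near: y; have /cvgrPdist_le := @cvg_id _ (nbhs x); exact.
  have vy : `|v n x - v n y| <= e / 3 by near: y; apply: vn; rewrite divr_gt0.
  move: (u x) (u y) (v n x) (v n y) ux uy vy => ? ? ? ?.
  by rewrite !ler_norml; lra.
have [g ug] := picard_step_total u_cont.
(* The limit is a fixed point: [g x] and [u x] are both within [2^-1 ^+ n * 2 * expR (L * |x|)] of
   [v n.+1 x], for every [n]. *)
have gu : g = u.
  apply/funext => x; apply/eqP; rewrite -subr_eq0 -normr_le0; apply/ler_addgt0Pl => e e0.
  rewrite addr0.
  have [n nP] := half_lim (4 * expR (L * `|x|)) e e0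
    ltac:(by rewrite mulr_ge0// expR_ge0).
  have c0 : 0 <= 2^-1 ^+ n * 4 :> R by rewrite mulr_ge0// exprn_ge0.
  have uv y : `|u y - v n y| <= 2^-1 ^+ n * 4 * expR (L * `|y|) by rewrite -mulrA.
  have := picard_step_contraction c0 ug (v_step n) uv x.
  have := uP x n.+1; rewrite exprS; move: nP; set t := expR _.
  move: (g x) (u x) (v n.+1 x) (2^-1 ^+ n) t => gx ux vx p t.
  by rewrite !ler_norml; lra.
have [A [B [Ad Bd AB gE]]] := ug.
(* The terms with [A'] and [B'] cancel in the first derivative, as always in variation of
   constants. *)
exists u, (fun x => - k * sin (k * x) * (1 + A x) + k * cos (k * x) * B x); split.
  split=> x.
    rewrite -gu gE; der; rewrite -gu; ring.
  have uE : u x = cos (k * x) * (1 + A x) + sin (k * x) * B x by rewrite -[in LHS]gu gE.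
  der; transitivity (q x * u x * (cos (k * x) ^+ 2 + sin (k * x) ^+ 2) -
      k ^+ 2 * (cos (k * x) * (1 + A x) + sin (k * x) * B x)).
    by field; rewrite gt_eqF.
  by rewrite cos2Dsin2 -uE; ring.
move=> x x1; rewrite -gu gE; have [-> ->] := AB _ x1.
by rewrite addr0 mulr1 mulr0 addr0.
Unshelve. all: by end_near. Qed.

End Picard.
End Solutions.

(** * The resonant bump potential *)

Section Bump.
Variable R : realType.
Implicit Types (q u du : R -> R) (a k l x y e : R).

Definition energy l u du x : R := du x ^+ 2 + l * u x ^+ 2.

Lemma energy_ge0 l u du x : 0 <= l -> 0 <= energy l u du x.
Proof. by move=> l0; exact: addr_ge0 (sqr_ge0 _) (mulr_ge0 l0 (sqr_ge0 _)). Qed.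

Section Formula.
Variables (k c L p r : R).

Let h n x := ((@cutoff R)^`(n))%classic ((x - c) / L).

(** The phase is a point [(p, r)] of the unit circle rather than an angle: [bump_sin] takes the
    value [r] at [c] and has slope [k * p] there. *)
Definition bump_sin x : R := p * sin (k * (x - c)) + r * cos (k * (x - c)).
Definition bump_cos x : R := p * cos (k * (x - c)) - r * sin (k * (x - c)).
(** The factor 4 gives total mass 4; as S^2 has mean 1/2, the exponent F grows by 2 across the
    interval. *)
Definition bump_w x : R := 4 / L * h 1 x.
Definition bump_w1 x : R := 4 / L ^+ 2 * h 2 x.
Definition bump_w2 x : R := 4 / L ^+ 3 * h 3 x.
Local Notation S := bump_sin.
Local Notation C := bump_cos.
Local Notation w := bump_w.
Local Notation w1 := bump_w1.
Local Notation w2 := bump_w2.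

(* F' is close to w * S ^ 2, whose primitive is not explicit; integrating by parts
   and dropping a remainder gives F, which grows from 0 to 2 across the interval. *)
Definition bump_exp x : R := 2 * h 0 x - w x * S x * C x / (2 * k).
Definition bump_exp1 x : R := w x * S x ^+ 2 - w1 x * S x * C x / (2 * k).
Definition bump_exp2 x : R := w1 x * S x ^+ 2 + 2 * k * w x * S x * C x
  - w2 x * S x * C x / (2 * k) - w1 x * (C x ^+ 2 - S x ^+ 2) / 2.
Local Notation F := bump_exp.
Local Notation F1 := bump_exp1.
Local Notation F2 := bump_exp2.

(* This is [u'' / u + k ^ 2] for [u = expR (- F) * S].  The singular term
   [- 2 * F' * S' / S] of [u'' / u] is smooth because [F'] vanishes with [S]. *)
Definition bump x : R := F1 x ^+ 2 - F2 x - 2 * k * w x * S x * C x + w1 x * C x ^+ 2.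

Hypotheses (k_gt0 : 0 < k) (L_ge1 : 1 <= L) (pr1 : p ^+ 2 + r ^+ 2 = 1).

Let L_neq0 : L != 0. Proof. by rewrite gt_eqF// (lt_le_trans _ L_ge1). Qed.
Let k_neq0 : k != 0. Proof. by rewrite gt_eqF. Qed.

Lemma bump_sin2D x : S x ^+ 2 + C x ^+ 2 = 1.
Proof.
rewrite /S /C; transitivity ((p ^+ 2 + r ^+ 2) *
  (cos (k * (x - c)) ^+ 2 + sin (k * (x - c)) ^+ 2)); first by ring.
by rewrite pr1 cos2Dsin2 mulr1.
Qed.

Lemma bump_sin_le1 x : `|S x| <= 1.
Proof.
have := bump_sin2D x; have := sqr_ge0 (C x) => C0 SC.
by rewrite -(@expr_le1 _ 2)// real_normK ?num_real//; move: C0 SC; lra.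
Qed.

Lemma bump_cos_le1 x : `|C x| <= 1.
Proof.
have := bump_sin2D x; have := sqr_ge0 (S x) => C0 SC.
by rewrite -(@expr_le1 _ 2)// real_normK ?num_real//; move: C0 SC; lra.
Qed.

Lemma bump_sin_deriv : has_deriv S (fun x => k * C x).
Proof. by move=> x; rewrite /S /C; der; ring. Qed.

Lemma bump_cos_deriv : has_deriv C (fun x => - k * S x).
Proof. by move=> x; rewrite /S /C; der; ring. Qed.

Let h_deriv n : has_deriv (h n) (fun x => h n.+1 x / L).
Proof.
have hd : has_deriv ((@cutoff R)^`(n))%classic ((@cutoff R)^`(n.+1))%classic.
  by rewrite [X in has_deriv _ X]derive1nS; apply: derivable_has_deriv => x; exact: smooth_cutoff.
move=> x; rewrite /h; eapply is_derive_eq.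
  by eapply (der_comp hd); repeat der_step.
by rewrite /=; ring.
Qed.

Lemma bump_w_deriv : has_deriv w w1.
Proof.
have : has_deriv (h 1) (fun x => h 2 x / L) := h_deriv 1.
by rewrite /w /w1; move: (h 1) (h 2) => f g fd x; der; field.
Qed.

Lemma bump_w1_deriv : has_deriv w1 w2.
Proof.
have : has_deriv (h 2) (fun x => h 3 x / L) := h_deriv 2.
by rewrite /w1 /w2; move: (h 2) (h 3) => f g fd x; der; field.
Qed.

Lemma bump_exp_deriv : has_deriv F F1.
Proof.
have hd : has_deriv (h 0) (fun x => w x / 4).
  have : has_deriv (h 0) (fun x => h 1 x / L) := h_deriv 0.
  rewrite /w; move: (h 0) (h 1) => f g fd x.
  by apply: is_derive_eq (fd x) _; field.
have Fd x : is_derive x 1 F (w x / 2 - w1 x * S x * C x / (2 * k)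
    - w x * (C x ^+ 2 - S x ^+ 2) / 2).
  rewrite /F; have wd := bump_w_deriv; have Sd := bump_sin_deriv; have Cd := bump_cos_deriv.
  move: (h 0) w w1 S C hd wd Sd Cd => f W W1 s co fd wd sd cd.
  by der; field.
move=> x; apply: is_derive_eq (Fd x) _; rewrite /F1.
transitivity (w x * (S x ^+ 2 + C x ^+ 2) / 2 - w1 x * S x * C x / (2 * k)
  - w x * (C x ^+ 2 - S x ^+ 2) / 2); first by rewrite bump_sin2D mulr1.
by move: (w x) (w1 x) (S x) (C x) => W W1 s co; field.
Qed.

Lemma bump_exp1_deriv : has_deriv F1 F2.
Proof.
rewrite /F1 /F2; have wd := bump_w_deriv; have w1d := bump_w1_deriv.
have Sd := bump_sin_deriv; have Cd := bump_cos_deriv.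
move: w w1 w2 S C wd w1d Sd Cd => W W1 W2 s co wd w1d sd cd x.
by der; field.
Qed.

Lemma bump_w_out x : x <= c \/ c + L <= x -> [/\ w x = 0, w1 x = 0 & w2 x = 0].
Proof.
move=> xcL; have xt : (x - c) / L <= 0 \/ 1 <= (x - c) / L.
  have L0 : 0 < L by exact: lt_le_trans L_ge1.
  by rewrite ler_pdivrMr// ler_pdivlMr//; case: xcL => ?; [left|right]; lra.
by split; rewrite /w /w1 /w2 /h cutoff_derive_out ?mulr0.
Qed.

Lemma bump_out x : x <= c \/ c + L <= x -> bump x = 0.
Proof.
move=> /bump_w_out[wx w1x w2x].
by rewrite /bump /F1 /F2 wx w1x w2x; ring.
Qed.

Lemma smooth_bump : smooth bump.
Proof.
have kx : smooth (fun x => k * (x - c)).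
  apply: smoothM; first exact: smooth_cst.
  by apply: smoothD; [exact: smooth_id|exact: smooth_cst].
have hs n : smooth (h n).
  rewrite /h; apply: (@smooth_comp _ ((@cutoff R)^`(n))%classic).
    elim: n => [|n IH]; first exact: smooth_cutoff.
    by rewrite derive1nS; exact: smooth_derive1.
  apply: smoothM; last exact: smooth_cst.
  by apply: smoothD; [exact: smooth_id|exact: smooth_cst].
have sins : smooth (fun x => sin (k * (x - c))).
  by apply: smooth_comp kx; exact: (smooth_sin_cos R).1.
have coss : smooth (fun x => cos (k * (x - c))).
  by apply: smooth_comp kx; exact: (smooth_sin_cos R).2.
have Ss : smooth S := smoothD (smoothM (@smooth_cst R p) sins) (smoothM (@smooth_cst R r) coss).
have Cs : smooth C :=
  smoothD (smoothM (@smooth_cst R p) coss) (smoothN (smoothM (@smooth_cst R r) sins)).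
have ws : smooth w := smoothM (@smooth_cst R _) (hs 1%N).
have w1s : smooth w1 := smoothM (@smooth_cst R _) (hs 2%N).
have w2s : smooth w2 := smoothM (@smooth_cst R _) (hs 3%N).
rewrite /bump /F1 /F2; move: w w1 w2 S C ws w1s w2s Ss Cs => W W1 W2 s co ws w1s w2s ss cs.
by repeat lazymatch goal with
  | |- smooth (fun x => _ + _) => apply: smoothD
  | |- smooth (fun x => - _) => apply: smoothN
  | |- smooth (fun x => _ ^+ _) => apply: smoothX
  | |- smooth (fun x => _ * _) => apply: smoothM
  | H : smooth ?f |- smooth ?f => exact: H
  | _ => exact: smooth_cst
  end.
Qed.

Lemma bump_sol (A : R) : is_sol bump (k ^+ 2) (fun x => A * expR (- F x) * S x)
  (fun x => A * expR (- F x) * (k * C x - F1 x * S x)).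
Proof.
have Fd := bump_exp_deriv; have F1d := bump_exp1_deriv.
have Sd := bump_sin_deriv; have Cd := bump_cos_deriv.
split=> x.
  by move: F F1 S C Fd F1d Sd Cd => f f1 s co fd f1d sd cd; der; ring.
(* The cross term F' S' of u'' is a multiple of S, so u'' is a smooth multiple of u without any
   division by S. *)
have key : F1 x * k * C x = S x * k * (w x * S x * C x - w1 x * C x ^+ 2 / (2 * k)).
  by rewrite /F1; ring.
have -> : bump x = F1 x ^+ 2 - F2 x - 2 * k * w x * S x * C x + w1 x * C x ^+ 2 by [].
move: F F1 F2 S C w w1 Fd F1d Sd Cd key => f f1 f2 s co W W1 fd f1d sd cd key.
der; set E := expR _.
transitivity (A * E * (s x * (f1 x ^+ 2 - f2 x - k ^+ 2) - 2 * (f1 x * k * co x))).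
  by ring.
by rewrite key; field.
Qed.

End Formula.
End Bump.

(** * Size of the bump and of its leading term *)

Section BumpBounds.
Variable R : realType.
Implicit Types (q u du : R -> R) (c L p r a b k l x y e t : R).

Lemma norm_leM x y a b : `|x| <= a -> `|y| <= b -> `|x * y| <= a * b.
Proof. by move=> xa yb; rewrite normrM ler_pM. Qed.

Lemma norm_leD x y a b : `|x| <= a -> `|y| <= b -> `|x + y| <= a + b.
Proof. by move=> xa yb; rewrite (le_trans (ler_normD _ _))// lerD. Qed.

Lemma norm_leB x y a b : `|x| <= a -> `|y| <= b -> `|x - y| <= a + b.
Proof. by move=> xa yb; apply: norm_leD; rewrite ?normrN. Qed.

Lemma norm_le1M x y a : `|x| <= a -> `|y| <= 1 -> `|x * y| <= a.
Proof. by move=> xa y1; rewrite -[a]mulr1 norm_leM. Qed.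

(** [K] depends on [k] alone and not on position, length or phase: all derivatives of the cutoff are
    bounded and [1 <= L] absorbs the higher powers of 1/L. The last bound isolates the only part of
    order 1/L, namely - 2 w (S^2)', which is what gets averaged off resonance. *)
Lemma bump_bounds k : 0 < k -> exists2 K, 0 < K &
  forall c L p r, 1 <= L -> p ^+ 2 + r ^+ 2 = 1 -> forall x,
  [/\ `|bump_w c L x| <= K / L, `|bump_w1 c L x| <= K / L ^+ 2,
      `|bump_exp1 k c L p r x| <= K / L, `|bump k c L p r x| <= K / L &
      `|bump k c L p r x - bump_w c L x * (- 4 * k * bump_sin k c p r x * bump_cos k c p r x)|
        <= K / L ^+ 2].
Proof.
move=> k0; have [H1 H10 h1] := cutoff_derive_bound R 0.
have [H2 H20 h2] := cutoff_derive_bound R 1.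
have [H3 H30 h3] := cutoff_derive_bound R 2.
have [B BE] : exists B, B = 4 * (H1 + H2 + H3) by eexists.
have [K0 K0E] : exists K0, K0 = B + B / (2 * k) by eexists.
have [K1 K1E] : exists K1, K1 = K0 * K0 + B + B / (2 * k) + B + B by eexists.
have B0 : 0 < B by rewrite BE; lra.
have Bk : 0 < B / (2 * k) by rewrite divr_gt0// mulr_gt0.
have K00 : 0 < K0 by rewrite K0E addr_gt0.
have K10 : 0 < K1 by rewrite K1E !addr_gt0// mulr_gt0.
have kB0 : 0 < 4 * k * B by rewrite mulr_gt0// mulr_gt0.
have [K KE] : exists K, K = K0 + K1 + 4 * k * B + B by eexists.
have [K0K K1K BK KK] : [/\ K0 <= K, K1 <= K, B <= K & K1 + 4 * k * B <= K].
  by rewrite KE; move: kB0; move: (4 * k * B) => z z0; split; lra.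
exists K => [|c L p r L1 pr x]; first exact: lt_le_trans BK.
have L0 : 0 < L by exact: lt_le_trans L1.
have t0 : 0 < L^-1 by rewrite invr_gt0.
have t1 : L^-1 <= 1 by rewrite invf_le1.
move: t0 t1; set t := L^-1 => t0 t1.
have t2 : t ^+ 2 <= t by rewrite expr2 -[leRHS]mulr1 ler_pM2l.
have t3 : t ^+ 3 <= t ^+ 2 by rewrite exprS -[leRHS]mul1r ler_pM2r// exprn_gt0.
have t20 : 0 < t ^+ 2 by rewrite exprn_gt0.
have scale a z : 0 < a -> `|z| <= B / 4 -> `|4 * a * z| <= B * a.
  move=> a0 zB; rewrite (_ : B * a = 4 * a * (B / 4)); last by field.
  by apply: norm_leM zB; rewrite ger0_norm// mulr_ge0// ltW.
have Wb : `|bump_w c L x| <= B * t.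
  by rewrite /bump_w -/t; apply: scale => //; rewrite (le_trans (h1 _))// BE; lra.
have W1b : `|bump_w1 c L x| <= B * t ^+ 2.
  rewrite /bump_w1 -exprVn -/t; apply: scale => //.
  by rewrite (le_trans (h2 _))// BE; lra.
have W2b : `|bump_w2 c L x| <= B * t ^+ 2.
  rewrite (@le_trans _ _ (B * t ^+ 3)) ?ler_pM2l//.
  rewrite /bump_w2 -exprVn -/t; apply: scale; first by rewrite exprn_gt0.
  by rewrite (le_trans (h3 _))// BE; lra.
have Sb := bump_sin_le1 k c pr x; have Cb := bump_cos_le1 k c pr x.
rewrite -!exprVn -/t.
set S := bump_sin k c p r x in Sb *; set C := bump_cos k c p r x in Cb *.
set W := bump_w c L x in Wb *; set W1 := bump_w1 c L x in W1b *.
have S2b : `|S ^+ 2| <= 1 by rewrite normrX exprn_ile1.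
have C2b : `|C ^+ 2| <= 1 by rewrite normrX exprn_ile1.
have kinv : `|(2 * k)^-1| <= (2 * k)^-1 by rewrite ger0_norm// invr_ge0 ltW// mulr_gt0.
have F1b : `|bump_exp1 k c L p r x| <= K0 * t.
  rewrite /bump_exp1 -/S -/C -/W -/W1 (_ : K0 * t = B * t + B * t / (2 * k)); last first.
    by rewrite K0E; ring.
  apply: norm_leB; first exact: norm_le1M Wb S2b.
  apply: norm_leM kinv; rewrite (le_trans (norm_le1M (norm_le1M W1b Sb) Cb))//.
  by rewrite ler_pM2l.
have Kt a : a <= K -> a * t <= K * t by move=> aK; rewrite ler_pM2r.
have Kt2 a : a <= K -> a * t ^+ 2 <= K * t ^+ 2 by move=> aK; rewrite ler_pM2r.
have rb : `|bump k c L p r x - W * (- 4 * k * S * C)| <= K1 * t ^+ 2.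
  have -> : bump k c L p r x - W * (- 4 * k * S * C) =
      bump_exp1 k c L p r x * bump_exp1 k c L p r x - W1 * S ^+ 2
      + bump_w2 c L x * S * C * (2 * k)^-1 + W1 * ((C ^+ 2 - S ^+ 2) / 2) + W1 * C ^+ 2.
    by rewrite /bump /bump_exp2 -/S -/C -/W -/W1; field; rewrite gt_eqF.
  rewrite (_ : K1 * t ^+ 2 = K0 * t * (K0 * t) + B * t ^+ 2 + B * t ^+ 2 * (2 * k)^-1
     + B * t ^+ 2 + B * t ^+ 2); last by rewrite K1E; ring.
  apply: norm_leD (norm_le1M W1b C2b); apply: norm_leD; last first.
    apply: norm_le1M W1b _; rewrite normrM [`|2^-1|]ger0_norm// ler_pdivrMr// mul1r.
    by rewrite (le_trans (norm_leB C2b S2b)).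
  apply: norm_leD; last exact: norm_leM (norm_le1M (norm_le1M W2b Sb) Cb) kinv.
  exact: norm_leB (norm_leM F1b F1b) (norm_le1M W1b S2b).
have sb : `|W * (- 4 * k * S * C)| <= 4 * k * B * t.
  rewrite (_ : W * _ = (- (4 * k) * W) * S * C); last by ring.
  rewrite -[leRHS]mulrA; apply: (fun H => norm_le1M (norm_le1M H Sb) Cb).
  apply: norm_leM Wb.
  by rewrite normrN ger0_norm// ltW// mulr_gt0.
split.
- by rewrite (le_trans Wb)// Kt.
- by rewrite (le_trans W1b)// Kt2.
- by rewrite (le_trans F1b)// Kt.
- rewrite -[bump _ _ _ _ _ _](subrK (W * (- 4 * k * S * C))).
  rewrite (le_trans (norm_leD rb sb))// (@le_trans _ _ (K1 * t + 4 * k * B * t))//.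
    by rewrite lerD2r ler_pM2l.
  by rewrite -mulrDl Kt.
- by rewrite (le_trans rb)// Kt2.
Qed.

End BumpBounds.

(** * Effect of a bump on the energies *)

Section BumpEstimates.
Variable R : realType.
Implicit Types (q u du : R -> R) (c L p r a b k l x y e t A : R).

(** Turns the division by [1 - G / L] in the averaging argument into an exponential factor. *)
Lemma expR_inv_bound x : 0 <= x -> x <= 1 / 2 -> 1 <= (1 - x) * expR (2 * x).
Proof.
move=> x0 x1; rewrite (@le_trans _ _ ((1 - x) * (1 + 2 * x)))//.
  have -> : (1 - x) * (1 + 2 * x) = 1 + x * (1 - 2 * x) by ring.
  by rewrite lerDl mulr_ge0//; lra.
by rewrite ler_wpM2l ?expR_ge1Dx//; lra.
Qed.

Lemma sqr_energy_le l u du x : 0 < l -> `|u x ^+ 2| <= l^-1 * energy l u du x.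
Proof.
move=> l0; rewrite ger0_norm ?sqr_ge0// ler_pdivlMl// /energy lerDr sqr_ge0//.
Qed.

Lemma dsqr_energy_le l u du x : 0 < l -> `|du x ^+ 2| <= energy l u du x.
Proof.
move=> l0; rewrite ger0_norm ?sqr_ge0// /energy lerDl.
by rewrite mulr_ge0 ?sqr_ge0// ltW.
Qed.

Lemma mul_energy_le l u du x : 0 < l -> `|u x * du x| <= (1 + l^-1) * energy l u du x.
Proof.
move=> l0; have := sqr_energy_le u du x l0; have := dsqr_energy_le u du x l0.
rewrite (ger0_norm (sqr_ge0 (du x))) (ger0_norm (sqr_ge0 (u x))) mulrDl mul1r => H1 H2.
have : `|u x * du x| <= u x ^+ 2 + du x ^+ 2.
  have := sqr_ge0 (u x - du x); have := sqr_ge0 (u x + du x).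
  have := sqr_ge0 (u x); have := sqr_ge0 (du x).
  rewrite ler_norml; move: (u x) (du x) => a b b2 a2.
  have -> : (a + b) ^+ 2 = a ^+ 2 + b ^+ 2 + 2 * (a * b) by ring.
  have -> : (a - b) ^+ 2 = a ^+ 2 + b ^+ 2 - 2 * (a * b) by ring.
  by move: (a * b) (a ^+ 2) (b ^+ 2) b2 a2 => ? ? ? ? ?; lra.
move=> /le_trans; apply; rewrite addrC; exact: lerD.
Qed.

(* Averaging: the correction term cancels the oscillating, O(1/L), part of the
   derivative of the energy, because l != k ^ 2. *)
Lemma bump_nonresonant k l e : 0 < k -> 0 < l -> l != k ^+ 2 -> 0 < e ->
  exists2 L0, 1 <= L0 & forall c L p r q u du, L0 <= L -> p ^+ 2 + r ^+ 2 = 1 ->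
    is_sol q l u du -> (forall x, c <= x <= c + L -> q x = bump k c L p r x) ->
  forall x, c <= x <= c + L -> energy l u du x <= expR e * energy l u du c.
Proof.
move=> k0 l0 lk e0; have [K K0 KP] := bump_bounds k0.
have [g gE] : exists g, g = (2 * (l - k ^+ 2))^-1 by eexists.
have gl : 4 * g * (l - k ^+ 2) = 2.
  by rewrite gE; field; rewrite subr_eq0.
have [m mE] : exists m, m = 1 + l^-1 by eexists.
have m0 : 0 < m by rewrite mE ltr_wpDr// invr_ge0 ltW.
have [Q QE] : exists Q, Q = 4 * k + 4 * k + 4 * k ^+ 2 * m by eexists.
have k20 : 0 < 4 * k ^+ 2 by rewrite mulr_gt0// exprn_gt0.
have Q0 : 0 < Q by rewrite QE !addr_gt0// mulr_gt0.
have [G GE] : exists G, G = `|g| * K * Q by eexists.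
have G0 : 0 <= G by rewrite GE !mulr_ge0// ltW.
have [D DE] : exists D, D = 2 * K * m + `|g| * K * Q +
  `|g| * (K * K) * (2 * (4 * k) * m + 4 * k ^+ 2 * l^-1) by eexists.
have D0 : 0 <= D.
  rewrite DE -GE addr_ge0 ?addr_ge0// ?mulr_ge0 ?(ltW m0) ?(ltW K0)//.
  by rewrite addr_ge0 ?mulr_ge0 ?invr_ge0 ?(ltW k20) ?(ltW l0) ?(ltW k0) ?(ltW m0).
(* [G / L] bounds the correction relative to the energy and [D / L ^+ 2] its corrected derivative.
   The summand [2 * G] ensures [G / L <= 1 / 2]; the quotient by [e] ensures that the final exponent
   [2 * (G / L) + 2 * (D / L)] is at most [e]. *)
exists (1 + 2 * G + (2 * G + 2 * D) / e).
  by rewrite -addrA lerDl addr_ge0 ?mulr_ge0 ?addr_ge0 ?invr_ge0 ?mulr_ge0// ltW.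
move=> c L p r q u du LL0 pr [ud dud] qb.
have GD0 : 0 <= (2 * G + 2 * D) / e by rewrite divr_ge0 ?(ltW e0)// addr_ge0 ?mulr_ge0.
have L1 : 1 <= L by move: LL0 GD0; move: (_ / e) => z; lra.
have L0 : 0 < L by exact: lt_le_trans L1.
have GL : G / L <= 1 / 2.
  by rewrite ler_pdivrMr//; move: LL0 GD0; move: (_ / e) => z; lra.
have GDL : 2 * (G / L) + 2 * (D / L) <= e.
  rewrite !mulrA -mulrDl ler_pdivrMr// [e * L]mulrC -ler_pdivrMr//.
  by move: LL0; move: (_ / e) => z; lra.
have := bump_sin_deriv k c p r; have := bump_cos_deriv k c p r.
have := bump_w_deriv c L1; have := bump_sin2D k c pr.
have := bump_sin_le1 k c pr; have := bump_cos_le1 k c pr.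
have [+ _ _] := @bump_w_out _ c L L1 c (or_introl (lexx c)).
have := KP c L p r L1 pr; move: qb.
move: (bump k c L p r) (bump_sin k c p r) (bump_cos k c p r) (bump_w c L) (bump_w1 c L).
move=> b S C w w1 qb KPx wc Cb Sb SC wd Cd Sd.
have [s sE] : exists s, s = fun x => - 4 * k * S x * C x by eexists.
have [s1 s1E] : exists s1, s1 = fun x => - (4 * k ^+ 2) * (C x ^+ 2 - S x ^+ 2) by eexists.
have sd : has_deriv s s1 by rewrite sE s1E => x; der; ring.
have s1d : has_deriv s1 (fun x => - (4 * k ^+ 2) * s x).
  by rewrite sE s1E => x; der; ring.
have sb x : `|s x| <= 4 * k.
  rewrite sE (norm_le1M (norm_le1M _ (Sb x)) (Cb x))//.
  by rewrite mulNr normrN ger0_norm// ltW// mulr_gt0.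
have s1b x : `|s1 x| <= 4 * k ^+ 2.
  rewrite s1E norm_le1M//; first by rewrite normrN ger0_norm// ltW.
  have := SC x; have := sqr_ge0 (S x); have := sqr_ge0 (C x); rewrite ler_norml.
  by move: (S x ^+ 2) (C x ^+ 2) => ? ? ? ? ?; lra.
have wb x : `|w x| <= K / L by case: (KPx x).
have w1b x : `|w1 x| <= K / L ^+ 2 by case: (KPx x).
pose N := energy l u du.
(* Since s'' = - 4 k^2 s, one gets X' = - 4 (l - k^2) s u u' + q (2 s u u' - s' u^2). With g = 1 /
   (2 (l - k^2)), the first part of g w X' cancels the leading part 2 w s u u' of N' = 2 q u u'.
   What is left carries q - w s, w' or w q, each O(1/L^2). *)
pose X x := s x * du x ^+ 2 - s x * (l * u x ^+ 2) - s1 x * (u x * du x).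
pose E x := N x + g * (w x * X x).
pose dE x := 2 * (q x - w x * s x) * (u x * du x) + g * (w1 x * X x)
  + g * (w x * q x) * (2 * s x * (u x * du x) - s1 x * u x ^+ 2).
have Ed : has_deriv E dE.
  have dEE x : dE x = 2 * q x * u x * du x
     - (4 * g * (l - k ^+ 2)) * w x * s x * u x * du x + g * (w1 x * X x)
     + g * w x * (2 * s x * q x * u x * du x - s1 x * q x * u x ^+ 2).
    by rewrite gl /dE; ring.
  rewrite /E /N /energy /X; move=> x; apply: (@is_derive_eq _ _ _ _ _ _ _ _ _ (esym (dEE x))).
  by der; rewrite /X; ring.
have N0 x : 0 <= N x by exact/energy_ge0/ltW.
have u2b x : `|u x ^+ 2| <= l^-1 * N x := sqr_energy_le u du x l0.
have du2b x : `|du x ^+ 2| <= N x := dsqr_energy_le u du x l0.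
have udub x : `|u x * du x| <= m * N x by rewrite mE; exact: mul_energy_le.
have lu2b x : `|l * u x ^+ 2| <= N x.
  by rewrite normrM ger0_norm ?(ltW l0)// -ler_pdivlMl.
have Xb x : `|X x| <= Q * N x.
  rewrite QE (_ : _ * N x = 4 * k * N x + 4 * k * N x + 4 * k ^+ 2 * (m * N x)); last by ring.
  exact: norm_leB (norm_leB (norm_leM (sb x) (du2b x)) (norm_leM (sb x) (lu2b x)))
    (norm_leM (s1b x) (udub x)).
have corr x : `|g * (w x * X x)| <= G / L * N x.
  rewrite (_ : G / L * N x = `|g| * (K / L * (Q * N x))); last by rewrite GE; ring.
  exact: norm_leM (lexx _) (norm_leM (wb x) (Xb x)).
have dEb x : c <= x <= c + L -> `|dE x| <= D / L ^+ 2 * N x.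
  move=> xcL; have [_ _ _ qb1 qb2] := KPx x.
  have sx : - 4 * k * S x * C x = s x by rewrite sE.
  rewrite -(qb x xcL) in qb1; rewrite -(qb x xcL) sx in qb2.
  rewrite (_ : D / L ^+ 2 * N x = 2 * (K / L ^+ 2) * (m * N x) +
     `|g| * (K / L ^+ 2 * (Q * N x)) +
     `|g| * (K / L * (K / L)) * (2 * (4 * k) * (m * N x) + 4 * k ^+ 2 * (l^-1 * N x))).
    have n2 : `|2| <= 2 :> R by rewrite ger0_norm.
    apply: norm_leD.
      apply: norm_leD; first exact: norm_leM (norm_leM n2 qb2) (udub x).
      exact: norm_leM (lexx _) (norm_leM (w1b x) (Xb x)).
    apply: norm_leM; first exact: norm_leM (lexx _) (norm_leM (wb x) qb1).
    exact: norm_leB (norm_leM (norm_leM n2 (sb x)) (udub x)) (norm_leM (s1b x) (u2b x)).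
  rewrite DE; field.
  by rewrite gt_eqF//= gt_eqF.
have EN x : (1 - G / L) * N x <= E x.
  have := corr x; rewrite ler_norml mulrBl mul1r /E => /andP[H _].
  by move: (G / L * N x) (g * _) (N x) H => ? ? ?; lra.
(* This closes the Gronwall inequality: the derivative of [E] is bounded in terms of [N], hence of
   [E] itself. *)
have NE x : N x <= 2 * E x.
  have H1 := EN x; have H2 : G / L * N x <= 1 / 2 * N x by exact: ler_wpM2r.
  rewrite mulrBl mul1r in H1.
  by move: (G / L * N x) (E x) (N x) H1 H2 => ? ? ?; lra.
move=> x xcL.
have := gronwall (M := 2 * (D / L ^+ 2)) Ed _ xcL.
have -> : E c = N c by rewrite /E wc mul0r mulr0 addr0.
move=> Ex; have {}Ex : E x <= N c * expR (2 * (D / L ^+ 2) * (x - c)).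
  apply: Ex => y ycL; rewrite (le_trans (ler_norm _))// (le_trans (dEb y ycL))//.
  rewrite (_ : _ * E y = D / L ^+ 2 * (2 * E y)); last by ring.
  by rewrite ler_wpM2l// divr_ge0// exprn_ge0// ltW.
have Ex2 : E x <= N c * expR (2 * (D / L)).
  rewrite (le_trans Ex)// ler_wpM2l// ler_expR -mulrA ler_wpM2l//.
  rewrite (_ : D / L = D / L ^+ 2 * L); last by field; rewrite gt_eqF.
  rewrite ler_wpM2l ?divr_ge0 ?exprn_ge0 ?(ltW L0)//.
  by move: xcL => /andP[_]; lra.
have GL0 : 0 <= G / L by rewrite divr_ge0// ltW.
have H1 := expR_inv_bound GL0 GL.
apply: (@le_trans _ _ ((1 - G / L) * expR (2 * (G / L)) * N x)).
  by rewrite -[leLHS]mul1r ler_wpM2r.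
rewrite mulrAC; apply: (@le_trans _ _ (N c * expR (2 * (D / L)) * expR (2 * (G / L)))).
  by rewrite ler_wpM2r ?expR_ge0// (le_trans (EN x)).
rewrite -mulrA -expRD mulrC ler_wpM2r// ler_expR addrC.
exact: GDL.
Qed.

(** The data at [c] match the phase of the bump, so by uniqueness u = A e^(-F) S on the interval. F'
    vanishes at both ends, where the energy is therefore A^2 k^2 e^(-2F), with F = 0 at the left end
    and F = 2 at the right end. *)
Lemma bump_resonant k e : 0 < k -> 0 < e ->
  exists2 L0, 1 <= L0 & forall c L p r q u du A, L0 <= L -> p ^+ 2 + r ^+ 2 = 1 ->
    is_sol q (k ^+ 2) u du -> (forall x, c <= x <= c + L -> q x = bump k c L p r x) ->
    u c = A * r -> du c = A * (k * p) ->
  (forall x, c <= x <= c + L ->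
    energy (k ^+ 2) u du x <= expR e * energy (k ^+ 2) u du c) /\
  energy (k ^+ 2) u du (c + L) = expR (- 4) * energy (k ^+ 2) u du c.
Proof.
move=> k0 e0; have [K K0 KP] := bump_bounds k0.
have Kk : 0 < 4 * K / k by rewrite divr_gt0// mulr_gt0.
exists (1 + 4 * K / k / e) => [|c L p r q u du A LL0 pr usol qb uc duc].
  by rewrite lerDl divr_ge0// ltW.
have L1 : 1 <= L by rewrite (le_trans _ LL0)// lerDl divr_ge0// ltW.
have L0 : 0 < L by exact: lt_le_trans L1.
have KLe : 4 * K / k / L <= e.
  rewrite ler_pdivrMr// [e * L]mulrC -ler_pdivrMr// (le_trans _ LL0)//.
  by rewrite lerDr.
have bs := bump_sol c k0 L1 pr A.
set F := bump_exp k c L p r in bs; set F1 := bump_exp1 k c L p r in bs.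
set S := bump_sin k c p r in bs; set C := bump_cos k c p r in bs.
have Sc : S c = r by rewrite /S /bump_sin subrr mulr0 sin0 cos0; ring.
have Cc : C c = p by rewrite /C /bump_cos subrr mulr0 sin0 cos0; ring.
have [wc w1c _] := @bump_w_out _ c L L1 c (or_introl (lexx c)).
have [wd w1d _] := @bump_w_out _ c L L1 (c + L) (or_intror (lexx _)).
have Fc : F c = 0.
  rewrite /F /bump_exp wc subrr mul0r derive1n0 cutoff0; ring.
have Fd : F (c + L) = 2.
  rewrite /F /bump_exp wd addrAC subrr add0r divff ?gt_eqF// derive1n0 cutoff1; ring.
have F1c : F1 c = 0 by rewrite /F1 /bump_exp1 wc w1c; ring.
have F1d : F1 (c + L) = 0 by rewrite /F1 /bump_exp1 wd w1d; ring.
have cc : c <= c <= c + L by rewrite lexx lerDl ltW.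
have cd : c <= c + L <= c + L by rewrite lexx lerDl ltW.
have eqs : forall x, c <= x <= c + L -> u x = A * expR (- F x) * S x /\
    du x = A * expR (- F x) * (k * C x - F1 x * S x).
  have cb : continuous (bump k c L p r).
    have bsm : smooth (bump k c L p r) by exact: smooth_bump.
    exact: has_deriv_continuous (smooth_deriv bsm).
  have uc' : A * expR (- F c) * S c = u c by rewrite Fc oppr0 expR0 mulr1 Sc uc.
  have duc' : A * expR (- F c) * (k * C c - F1 c * S c) = du c.
    by rewrite Fc oppr0 expR0 mulr1 F1c Sc Cc duc; ring.
  move=> x xcL.
  by have [<- <-] := is_sol_eq cb bs usol (fun y yc => esym (qb y yc)) uc' duc' xcL.
have SC x : S x ^+ 2 + C x ^+ 2 = 1 := bump_sin2D k c pr x.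
have enE x : c <= x <= c + L -> energy (k ^+ 2) u du x =
    A ^+ 2 * expR (- F x) ^+ 2 * (k ^+ 2 + (- 2 * k * F1 x * S x * C x + F1 x ^+ 2 * S x ^+ 2)).
  move=> xcL; rewrite /energy; have [-> ->] := eqs x xcL.
  transitivity (A ^+ 2 * expR (- F x) ^+ 2 * (k ^+ 2 * (S x ^+ 2 + C x ^+ 2) +
    (- 2 * k * F1 x * S x * C x + F1 x ^+ 2 * S x ^+ 2))); first by ring.
  by rewrite SC mulr1.
have enc : energy (k ^+ 2) u du c = A ^+ 2 * k ^+ 2.
  by rewrite enE// Fc oppr0 expR0 F1c; ring.
split=> [x xcL|]; last first.
  have e4 : expR (- 2) ^+ 2 = expR (- 4) :> R by rewrite -expRM_natl; congr expR; ring.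
  by rewrite enE// enc Fd F1d e4; ring.
have Sb : `|S x| <= 1 := bump_sin_le1 k c pr x.
have Cb : `|C x| <= 1 := bump_cos_le1 k c pr x.
have [wb _ F1b _ _] := KP c L p r L1 pr x.
(* Inside the interval - F <= z, and F' changes the energy by at most the factor (1 + z)^2 <=
   e^(2z). In total the factor is e^(4z), and the choice of the threshold on [L] makes 4z <= e. *)
pose z := K / L / k.
have z0 : 0 <= z by rewrite !divr_ge0// ltW.
have Fb : - F x <= z.
  rewrite /F /bump_exp opprB lerBlDr (le_trans (ler_norm _))//.
  have wz : `|bump_w c L x * S x * C x / (2 * k)| <= z.
    rewrite (_ : z = K / L * k^-1)//; apply: norm_leM.
      exact: norm_le1M (norm_le1M wb Sb) Cb.
    rewrite ger0_norm ?invr_ge0 ?mulr_ge0 ?(ltW k0)// lef_pV2 ?posrE ?mulr_gt0//.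
    by rewrite ler_peMl ?ltW// ltr1n.
  by rewrite (le_trans wz)// lerDl mulr_ge0// cutoff_ge0.
have ez : k ^+ 2 + (- 2 * k * F1 x * S x * C x + F1 x ^+ 2 * S x ^+ 2) <= k ^+ 2 * expR z ^+ 2.
  apply: (@le_trans _ _ (k ^+ 2 * (1 + z) ^+ 2)); last first.
    rewrite ler_wpM2l ?sqr_ge0// lerXn2r ?nnegrE ?expR_ge0 ?expR_ge1Dx//.
    by rewrite addr_ge0.
  rewrite (_ : k ^+ 2 * (1 + z) ^+ 2 = k ^+ 2 + (2 * k * (K / L) + K / L * (K / L))).
    rewrite lerD2l (le_trans (ler_norm _))//; apply: norm_leD.
      apply: norm_le1M Cb; apply: norm_le1M Sb; apply: norm_leM F1b.
      by rewrite mulNr normrN ger0_norm// mulr_ge0// ltW.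
    by apply: norm_le1M; [exact: norm_leM|rewrite normrX exprn_ile1].
  by rewrite /z; field; rewrite !gt_eqF.
rewrite enE// enc.
apply: (@le_trans _ _ (A ^+ 2 * expR z ^+ 2 * (k ^+ 2 * expR z ^+ 2))).
  apply: ler_pM => //.
  - by rewrite mulr_ge0// sqr_ge0.
  - have -> : k ^+ 2 + (- 2 * k * F1 x * S x * C x + F1 x ^+ 2 * S x ^+ 2) =
      (k * C x - F1 x * S x) ^+ 2 + k ^+ 2 * S x ^+ 2 + k ^+ 2 * (1 - (S x ^+ 2 + C x ^+ 2)).
      by ring.
    by rewrite SC subrr mulr0 addr0 addr_ge0 ?sqr_ge0// mulr_ge0 ?sqr_ge0.
  - by rewrite ler_wpM2l ?sqr_ge0// lerXn2r ?nnegrE ?expR_ge0// ler_expR.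
rewrite (_ : _ * _ = expR z ^+ 4 * (A ^+ 2 * k ^+ 2)); last by ring.
apply: ler_wpM2r; first by rewrite mulr_ge0// sqr_ge0.
rewrite -expRM_natl ler_expR.
rewrite (le_trans _ KLe)// le_eqVlt; apply/orP; left; apply/eqP.
by rewrite /z; field; rewrite !gt_eqF.
Qed.

End BumpEstimates.

(** * Dyadic supersteps *)

Section Superstep.
Variable R : realType.
Implicit Types (q u du : R -> R) (a b c L p r k x y e A : R) (n m i j : nat).

(** Prescribing [u] on all of [x <= 1], and not only at one point, is what later allows gluing with
    the reflected solution. *)
Definition std_sol q k u du :=
  is_sol q (k ^+ 2) u du /\ forall x, x <= 1 -> u x = cos (k * x).

Definition admissible q b :=
  [/\ smooth q, forall x, x <= 1 -> q x = 0 & forall x, b <= x -> q x = 0].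

Lemma std_sol0 q k u du : std_sol q k u du -> u 0 = 1 /\ du 0 = 0.
Proof.
move=> [[ud _] uE]; split; first by rewrite uE// mulr0 cos0.
have c0 : is_derive (0 : R) 1 (fun x => cos (k * x)) 0.
  by der; rewrite mulr0 sin0; ring.
have : is_derive (0 : R) 1 u 0.
  apply: near_eq_is_derive c0; near=> y; rewrite uE//.
  by near: y; apply: lt_le_nbhsl.
by move=> [_ u0]; case: (ud 0) => _ <-.
Unshelve. all: by end_near. Qed.

Lemma smooth_continuous q : smooth q -> continuous q.
Proof. by move=> qs; exact: has_deriv_continuous (smooth_deriv qs). Qed.

Lemma std_sol_eq q1 q2 k u du v dv b : smooth q1 -> std_sol q1 k u du ->
  std_sol q2 k v dv -> (forall x, x <= b -> q1 x = q2 x) ->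
  forall x, 0 <= x <= b -> u x = v x /\ du x = dv x.
Proof.
move=> /smooth_continuous q1c us vs q12.
have [u0 du0] := std_sol0 us; have [v0 dv0] := std_sol0 vs.
apply: (is_sol_eq q1c us.1 vs.1); rewrite ?u0 ?v0 ?du0 ?dv0//.
by move=> x /andP[_]; exact: q12.
Qed.

Lemma std_sol_exists q k M : 0 < k -> smooth q -> (forall x, x <= 1 -> q x = 0) ->
  (forall x, `|q x| <= M) -> exists u du, std_sol q k u du.
Proof.
move=> k0 /smooth_continuous qc q1 qM.
have M0 : 0 <= M by exact: le_trans (qM 0).
by have [u [du ?]] := solution_exists k0 M0 qc q1 qM; exists u, du.
Qed.

Lemma admissible_bounded q b : admissible q b -> exists M, forall x, `|q x| <= M.
Proof.
move=> [qs q1 qb]; have [M M0 MP] := bounded_on_segment 1 b (smooth_continuous qs).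
exists M => x; have [x1|x1] := leP x 1; first by rewrite q1// normr0 ltW.
have [xb|xb] := leP b x; first by rewrite qb// normr0 ltW.
by rewrite MP// !ltW.
Qed.

(** Energy estimates proved for an early stage of the potential survive all later extensions,
    because the standard solution up to [b] depends only on the potential up to [b]. *)
Lemma std_sol_restrict q1 q2 k u du b : 0 < k -> admissible q1 b -> std_sol q2 k u du ->
  (forall x, x <= b -> q1 x = q2 x) ->
  exists v dv, std_sol q1 k v dv /\
    forall x, 0 <= x <= b -> energy (k ^+ 2) u du x = energy (k ^+ 2) v dv x.
Proof.
move=> k0 q1a us q12; have [M MP] := admissible_bounded q1a.
have [q1s q11 _] := q1a.
have [v [dv vs]] := std_sol_exists k0 q1s q11 MP.
exists v, dv; split=> // x xb; rewrite /energy.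
by have [-> ->] := std_sol_eq q1s vs us q12 xb.
Qed.

Lemma polar_decomposition k x y : 0 < k ->
  exists A p r, [/\ p ^+ 2 + r ^+ 2 = 1, x = A * r & y = A * (k * p)].
Proof.
move=> k0; set z := y / k; set A := Num.sqrt (x ^+ 2 + z ^+ 2).
have S0 : 0 <= x ^+ 2 + z ^+ 2 by rewrite addr_ge0 ?sqr_ge0.
have A2 : A ^+ 2 = x ^+ 2 + z ^+ 2 by rewrite sqr_sqrtr.
have yz : y = k * z by rewrite /z mulrC divfK// gt_eqF.
have [A0|A0] := eqVneq A 0.
  (* Zero data have no phase; any point of the circle will do. *)
  exists 0, 1, 0; rewrite expr1n expr0n/= addr0 !mul0r yz; split=> //.
    move: A2; rewrite A0 expr0n/= => /esym/eqP; rewrite paddr_eq0 ?sqr_ge0//.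
    by rewrite !sqrf_eq0 => /andP[/eqP].
  move: A2; rewrite A0 expr0n/= => /esym/eqP; rewrite paddr_eq0 ?sqr_ge0//.
  by rewrite !sqrf_eq0 => /andP[_ /eqP->]; rewrite mulr0.
exists A, (z / A), (x / A); split.
- transitivity ((x ^+ 2 + z ^+ 2) / A ^+ 2); first by field.
  by rewrite -A2 divff// expf_neq0.
- by rewrite mulrC divfK.
- by rewrite yz; field.
Qed.

Lemma finite_family_bound n (f : nat -> R) :
  exists2 B, 1 <= B & forall i, (i < n)%N -> f i <= B.
Proof.
elim: n => [|n [B B1 BP]]; first by exists 1.
exists (Num.max B (f n)) => [|i]; first by rewrite le_max B1.
rewrite ltnS leq_eqVlt => /predU1P[->|/BP fB]; first by rewrite le_max lexx orbT.
by rewrite le_max fB.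
Qed.

Variable k : nat -> R.
Hypothesis k_gt0 : forall j, 0 < k j.

(** Appends one bump tuned to the energy of index [i], with its phase read off at [c] from the
    standard solution of [q0]. The other energies influence only the threshold [L0]. *)
Lemma bump_step n i e : 0 < e -> exists K L0, [/\ 0 < K, 1 <= L0 &
  forall q0 c L, admissible q0 c -> 1 <= c -> L0 <= L ->
  exists q1, [/\ admissible q1 (c + L), forall x, x <= c -> q1 x = q0 x,
    forall x, c <= x -> `|q1 x| <= K / L &
    forall j, (j < n)%N -> forall u du, std_sol q1 (k j) u du ->
    (forall x, c <= x <= c + L ->
      energy (k j ^+ 2) u du x <= expR e * energy (k j ^+ 2) u du c) /\
    (j = i -> energy (k j ^+ 2) u du (c + L) = expR (- 4) * energy (k j ^+ 2) u du c)]].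
Proof.
move=> e0; have [K K0 KP] := bump_bounds (k_gt0 i).
have [Lr Lr1 LrP] := bump_resonant (k_gt0 i) e0.
have /choice[Ln LnP] : forall j, exists Lj, k j != k i -> 1 <= Lj /\
  forall c L p r q u du, Lj <= L -> p ^+ 2 + r ^+ 2 = 1 ->
    is_sol q (k j ^+ 2) u du -> (forall x, c <= x <= c + L -> q x = bump (k i) c L p r x) ->
    forall x, c <= x <= c + L ->
      energy (k j ^+ 2) u du x <= expR e * energy (k j ^+ 2) u du c.
  move=> j; have [->|kj] := eqVneq (k j) (k i); first by exists 0.
  have [||Lj Lj1 LjP] := @bump_nonresonant R (k i) (k j ^+ 2) e (k_gt0 i) _ _ e0.
  - by rewrite exprn_gt0.
  - by rewrite eqrXn2// ltW.
  - by exists Lj.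
have [B B1 BP] := finite_family_bound n Ln.
exists K, (Num.max Lr B); split=> // [|q0 c L q0a c1]; first by rewrite le_max B1 orbT.
rewrite ge_max => /andP[LrL BL].
have L1 : 1 <= L by exact: le_trans BL.
have L0 : 0 < L by exact: lt_le_trans L1.
have [q0s q01 q0c] := q0a; have [M MP] := admissible_bounded q0a.
have [v [dv vs]] := std_sol_exists (k_gt0 i) q0s q01 MP.
have [A [p [r [pr vc dvc]]]] := polar_decomposition (v c) (dv c) (k_gt0 i).
pose b := bump (k i) c L p r.
have bout x : x <= c \/ c + L <= x -> b x = 0 by exact: bump_out.
pose q1 x := q0 x + b x.
have q10 x : x <= c -> q1 x = q0 x by move=> xc; rewrite /q1 bout ?addr0//; left.
have q1b x : c <= x -> q1 x = b x by move=> cx; rewrite /q1 q0c ?add0r.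
exists q1; split=> // [|x cx|j jn u du us].
- split.
  + have bs : smooth b by exact: smooth_bump.
    exact: smoothD q0s bs.
  + by move=> x x1; rewrite q10 ?q01// (le_trans x1).
  + move=> x cLx; rewrite q1b ?bout//; first by right.
    by rewrite (le_trans _ cLx)// lerDl ltW.
- by rewrite q1b//; have [] := KP c L p r L1 pr x.
have qb x : c <= x <= c + L -> q1 x = b x by move=> /andP[cx _]; exact: q1b.
(* The split is on values and not on indices, since [k] may repeat a value: then the bump is
   resonant for each index having that value. *)
have [kji|kji] := eqVneq (k j) (k i).
  rewrite kji in us *.
  have c01 : 0 <= c <= c by rewrite lexx andbT (le_trans ler01).
  have [uc duc] := std_sol_eq q0s vs us (fun x xc => esym (q10 x xc)) c01.
  have [H1 H2] := LrP c L p r q1 u du A LrL pr us.1 qb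
    (etrans (esym uc) vc) (etrans (esym duc) dvc).
  by split=> // _.
have [_ H] := LnP j kji; split; last by move=> ji; rewrite ji eqxx in kji.
apply: H us.1 qb => //; exact: le_trans (BP j jn) BL.
Qed.

(** Lays [n.+1] bumps of length [a / n.+1] end to end on [[a, 2 * a]], the one of rank m tuned to
    [k m]. *)
Lemma superstep n : exists K T, [/\ 0 <= K, 1 <= T &
  forall q0 a, admissible q0 a -> T <= a ->
  exists q1, [/\ admissible q1 (2 * a), forall x, x <= a -> q1 x = q0 x,
    forall x, a <= x -> `|q1 x| <= K / a &
    forall j, (j < n.+1)%N -> forall u du, std_sol q1 (k j) u du ->
    (forall x, a <= x <= 2 * a ->
      energy (k j ^+ 2) u du x <= expR 1 * energy (k j ^+ 2) u du a) /\
    energy (k j ^+ 2) u du (2 * a) <= energy (k j ^+ 2) u du a / 4]].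
Proof.
(* Each of the [n.+1] bumps may enlarge an energy by e^(1/(n+1)), which amounts to a factor e over
   the whole superstep. *)
pose e : R := n.+1%:R^-1.
have n0 : 0 < n.+1%:R :> R by rewrite ltr0n.
have e0 : 0 < e by rewrite invr_gt0.
have /choice[K KP] := fun i => bump_step n.+1 i e0.
have {KP} /choice[L0 stepP] := KP.
have [B B1 BP] := finite_family_bound n.+1 K.
have [D D1 DP] := finite_family_bound n.+1 L0.
exists (B * n.+1%:R), (D * n.+1%:R); split.
- by rewrite mulr_ge0// (le_trans ler01).
- by rewrite (le_trans D1)// ler_peMr ?ler1n// (le_trans ler01).
move=> q0 a q0a Da; pose L := a / n.+1%:R.
have DL : D <= L by rewrite ler_pdivlMr.
have L1 : 1 <= L by exact: le_trans DL.
have L0' : 0 < L by exact: lt_le_trans L1.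
have a1 : 1 <= a.
  by rewrite (le_trans _ Da)// (le_trans D1)// ler_peMr ?ler1n// (le_trans ler01).
have nL : n.+1%:R * L = a by rewrite /L mulrC divfK// gt_eqF.
suff /(_ n.+1 (leqnn _)) [q1 [q1a q10 q1b q1s]] : forall m, (m <= n.+1)%N -> exists q1,
   [/\ admissible q1 (a + m%:R * L), forall x, x <= a -> q1 x = q0 x,
    forall x, a <= x -> `|q1 x| <= B / L &
    forall j, (j < n.+1)%N -> forall u du, std_sol q1 (k j) u du ->
    (forall x, a <= x <= a + m%:R * L ->
      energy (k j ^+ 2) u du x <= expR (m%:R * e) * energy (k j ^+ 2) u du a) /\
    ((j < m)%N -> energy (k j ^+ 2) u du (a + m%:R * L) <=
      expR (m%:R * e - 4) * energy (k j ^+ 2) u du a)].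
  have aa : a + n.+1%:R * L = 2 * a by rewrite nL; ring.
  have ne : n.+1%:R * e = 1 by rewrite /e divff// gt_eqF.
  rewrite aa ne in q1a q1s; exists q1; split=> // [x ax|j jn u du us].
    rewrite (le_trans (q1b x ax))// le_eqVlt; apply/orP; left; apply/eqP.
    by rewrite /L; field; rewrite !gt_eqF// (lt_le_trans ltr01).
  have [H1 H2] := q1s j jn u du us; split=> //; rewrite (le_trans (H2 jn))// mulrC.
  rewrite ler_wpM2l ?energy_ge0 ?sqr_ge0//.
  (* The resonant gain and the total loss leave e^(-3), and e^3 >= 1 + 3. *)
  rewrite (_ : 1 - 4 = - 3); last by ring.
  rewrite expRN lef_pV2 ?posrE ?expR_gt0//.
  by rewrite (le_trans _ (expR_ge1Dx 3))//; lra.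
elim=> [_|m IH mn].
  exists q0; rewrite mul0r addr0; split=> // [x ax|j jn u du us].
    have [_ _ ->] := q0a => //; rewrite normr0 divr_ge0 ?(ltW L0')//.
    exact: le_trans B1.
  rewrite mul0r expR0; split=> // x xa; rewrite mul1r.
  by have /le_anti -> : a <= x <= a by [].
have [q1 [q1a q10 q1b q1s]] := IH (ltnW mn).
set c := a + m%:R * L in q1a q1s.
have ac : a <= c by rewrite lerDl mulr_ge0// ltW.
have c1 : 1 <= c by exact: le_trans ac.
have [Km0 _ /(_ q1 c L q1a c1 (le_trans (DP m mn) DL))[q2 [q2a q21 q2b q2s]]] := stepP m.
have cL : a + m.+1%:R * L = c + L by rewrite /c -natr1; ring.
exists q2; rewrite cL; split=> // [x xa|x ax|j jn u du us].
- by rewrite q21 ?q10// (le_trans xa).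
- have [xc|cx] := leP x c; first by rewrite q21// q1b.
  rewrite (le_trans (q2b x (ltW cx)))// ler_pM2r ?invr_gt0//; exact: BP.
have [H1 H2] := q2s j jn u du us.
have [v [dv [vs uv]]] := std_sol_restrict (k_gt0 j) q1a us (fun x xc => esym (q21 x xc)).
have [G1 G2] := q1s j jn v dv vs.
have a0 : 0 <= a by exact: le_trans a1.
have en0 x : 0 <= energy (k j ^+ 2) u du x by rewrite energy_ge0 ?sqr_ge0.
have uva : energy (k j ^+ 2) u du a = energy (k j ^+ 2) v dv a by rewrite uv ?a0.
have uvc : energy (k j ^+ 2) u du c = energy (k j ^+ 2) v dv c.
  by rewrite uv ?(le_trans a0) ?lexx.
have eS z : expR (m.+1%:R * e + z) = expR e * expR (m%:R * e + z).
  by rewrite -expRD -natr1; congr expR; ring.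
have eS0 : expR (m.+1%:R * e) = expR e * expR (m%:R * e).
  by have := eS 0; rewrite !addr0.
have e1 : 1 <= expR e by rewrite -expR0 ler_expR ltW.
have em1 : 1 <= expR (m%:R * e) by rewrite -expR0 ler_expR mulr_ge0// ltW.
have encc : energy (k j ^+ 2) u du c <= expR (m%:R * e) * energy (k j ^+ 2) u du a.
  by rewrite uva uvc G1// ac lexx.
have c_cL : c <= c + L <= c + L by rewrite lexx lerDl ltW.
split.
  move=> x /andP[ax xcL]; rewrite eS0 -mulrA; have [xc|cx] := leP x c.
    apply: (@le_trans _ _ (expR (m%:R * e) * energy (k j ^+ 2) u du a)).
      by rewrite uva uv ?(le_trans a0)// G1// ax.
    by rewrite ler_peMl// mulr_ge0// expR_ge0.
  rewrite (le_trans (H1 x _)) ?(ltW cx)// ler_wpM2l// expR_ge0.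
rewrite ltnS leq_eqVlt => /predU1P[jm|jm].
  rewrite (H2 jm) addrC expRD -mulrA ler_wpM2l ?expR_ge0//.
  rewrite (le_trans encc)// ler_wpM2r// ler_expR ler_wpM2r ?(ltW e0)//.
  by rewrite ler_nat.
rewrite eS -mulrA (le_trans (H1 _ c_cL))// ler_wpM2l ?expR_ge0//.
by rewrite uva uvc G2.
Qed.

End Superstep.

(** * The half-line potential *)

Section HalfLine.
Variables (R : realType) (k : nat -> R).
Hypothesis k_gt0 : forall j, 0 < k j.
Implicit Types (q u du : R -> R) (x y : R) (n s t j : nat).

(* K n bounds the potential of a superstep acting on the first n energies, and T n
   is the abscissa from which such supersteps are available. *)
Lemma superstep_family : exists K T : nat -> R, [/\ K 0%N = 0, T 0%N = 0,
  (forall n, 0 <= K n) & forall n q0 a, admissible q0 a -> 1 <= a -> T n <= a ->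
  exists q1, [/\ admissible q1 (2 * a), forall x, x <= a -> q1 x = q0 x,
    forall x, a <= x -> `|q1 x| <= K n / a &
    forall j, (j < n)%N -> forall u du, std_sol q1 (k j) u du ->
    (forall x, a <= x <= 2 * a ->
      energy (k j ^+ 2) u du x <= expR 1 * energy (k j ^+ 2) u du a) /\
    energy (k j ^+ 2) u du (2 * a) <= energy (k j ^+ 2) u du a / 4]].
Proof.
have /choice[K KP] := fun n => superstep k_gt0 n.
have {KP} /choice[T KT] := KP.
(* With no active energy the potential is continued by 0. The zero constants mean that this choice
   is available at every stage and costs nothing. *)
exists (fun n => if n is m.+1 then K m else 0), (fun n => if n is m.+1 then T m else 0).
split=> // [[|n]//|[|n] q0 a q0a a1 Ta]; first by case: (KT n).
  have [q0s q01 q0a0] := q0a; exists q0; split=> //.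
  - split=> // x ax; apply: q0a0; rewrite (le_trans _ ax)// ler_peMl ?ler1n//.
  - by move=> x ax; rewrite q0a0// normr0 mul0r.
by have [_ _] := KT n; apply.
Qed.

Lemma dyadic_cover x : 1 <= x -> exists s, 2 ^+ s <= x <= 2 ^+ s.+1.
Proof.
move=> x1; have [n xn] : exists n, x <= 2 ^+ n.
  exists (Num.truncn x).+1; have x0 : 0 <= x by exact: le_trans ler01 x1.
  have /andP[_ /ltW/le_trans] := truncn_itv x0; apply.
  by rewrite -natrX ler_nat ltnW// ltn_expl.
elim: n xn => [|n IH] xn; first by exists 0%N; rewrite x1 (le_trans xn)// expr1 expr0 ler1n.
by have [xn'|xn'] := leP x (2 ^+ n); [exact: IH|exists n; rewrite xn (ltW xn')].
Qed.

(** [N s] is the number of energies active on the dyadic interval of index [s]. [K] and [T] are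
    fixed before [N], so the schedule can be adapted to them; the condition on [K] makes the
    potential bounded by 1, as the global existence of solutions requires. *)
Lemma half_line_potential : exists K T : nat -> R, [/\ K 0%N = 0, T 0%N = 0,
  (forall n, 0 <= K n) & forall N : nat -> nat,
  (forall s, T (N s) <= 2 ^+ s) -> (forall s, K (N s) <= 2 ^+ s) ->
  exists q, [/\ smooth q, forall x, x <= 1 -> q x = 0,
    forall s x, 2 ^+ s <= x <= 2 ^+ s.+1 -> `|q x| <= K (N s) / 2 ^+ s &
    forall j, (exists s0, forall s, (s0 <= s)%N -> (j < N s)%N) ->
      exists u du, std_sol q (k j) u du /\
        exists B, forall x, 0 <= x -> u x ^+ 2 * (1 + x ^+ 2) <= B]].
Proof.
have [K [T [K0 T0 Kge0 KT]]] := superstep_family.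
exists K, T; split=> // N NT NK.
have two_ge1 s : 1 <= 2 ^+ s :> R by rewrite exprn_ege1// ler1n.
have two_mono s t : (s <= t)%N -> 2 ^+ s <= 2 ^+ t :> R.
  by move=> st; rewrite ler_weXn2l// ler1n.
(* The extension is chosen for all pairs, with a junk value on inadmissible ones, so that the stages
   [Q] are an ordinary recursion whose admissibility is proved afterwards. *)
have /choice[F FP] : forall sq : nat * (R -> R), exists q1, admissible sq.2 (2 ^+ sq.1) ->
  [/\ admissible q1 (2 ^+ sq.1.+1), forall x, x <= 2 ^+ sq.1 -> q1 x = sq.2 x,
    forall x, 2 ^+ sq.1 <= x -> `|q1 x| <= K (N sq.1) / 2 ^+ sq.1 &
    forall j, (j < N sq.1)%N -> forall u du, std_sol q1 (k j) u du ->
    (forall x, 2 ^+ sq.1 <= x <= 2 ^+ sq.1.+1 ->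
      energy (k j ^+ 2) u du x <= expR 1 * energy (k j ^+ 2) u du (2 ^+ sq.1)) /\
    energy (k j ^+ 2) u du (2 ^+ sq.1.+1) <= energy (k j ^+ 2) u du (2 ^+ sq.1) / 4].
  move=> [s q0] /=; have [q0a|q0n] := pselect (admissible q0 (2 ^+ s)); last by exists q0.
  have [q1 q1P] := KT (N s) q0 (2 ^+ s) q0a (two_ge1 s) (NT s).
  by exists q1; rewrite exprS.
pose Q := fix Q s := if s is t.+1 then F (t, Q t) else fun _ : R => 0.
have Qa s : admissible (Q s) (2 ^+ s).
  elim: s => [|s IH]; first by split=> //; exact: smooth_cst.
  by have [] := FP (s, Q s) IH.
have QP s := FP (s, Q s) (Qa s).
have Q_stable s t x : (s <= t)%N -> x <= 2 ^+ s -> Q t x = Q s x.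
  move=> + xs; elim: t => [|t IH]; first by rewrite leqn0 => /eqP->.
  rewrite leq_eqVlt => /predU1P[->//|st]; have [_ /= Qt _ _] := QP t.
  by rewrite Qt ?IH// (le_trans xs)// two_mono.
have /choice[sx sxP] : forall x, exists s, x < 2 ^+ s.
  move=> x; have [s /andP[_ xs]] := @dyadic_cover (Num.max 1 x) ltac:(by rewrite le_max lexx).
  exists s.+2; rewrite (@le_lt_trans _ _ (2 ^+ s.+1))//.
    by rewrite (le_trans _ xs)// le_max lexx orbT.
  by rewrite ltr_eXn2l// ltr1n.
pose q x := Q (sx x) x.
have qQ s x : x <= 2 ^+ s -> q x = Q s x.
  move=> xs; rewrite -(@Q_stable _ (maxn s (sx x)) _ (leq_maxl _ _) xs).
  by rewrite (@Q_stable _ (maxn s (sx x)) _ (leq_maxr _ _) (ltW (sxP x))).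
have qs : smooth q.
  apply: smooth_local => x; have [Qs _ _] := Qa (sx x); exists (Q (sx x)) => //.
  by near=> y; rewrite (qQ (sx x))//; near: y; apply: lt_le_nbhsl.
have q1 x : x <= 1 -> q x = 0.
  by move=> x1; rewrite (qQ 0%N)// expr0.
have qb s x : 2 ^+ s <= x <= 2 ^+ s.+1 -> `|q x| <= K (N s) / 2 ^+ s.
  by move=> /andP[sx1 sx2]; rewrite (qQ s.+1)//; have [_ _ H _] := QP s; exact: H.
have q_bounded x : `|q x| <= 1.
  have [x1|x1] := leP x 1; first by rewrite q1// normr0.
  have [s sP] := dyadic_cover (ltW x1); rewrite (le_trans (qb s x sP))//.
  by rewrite ler_pdivrMr ?exprn_gt0// mul1r.
exists q; split=> // j [s0 s0P].
have [u [du us]] := std_sol_exists (k_gt0 j) qs q1 q_bounded.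
exists u, du; split=> //.
pose E := energy (k j ^+ 2) u du.
have k20 : 0 < k j ^+ 2 by rewrite exprn_gt0.
have E0 x : 0 <= E x by rewrite energy_ge0 ?ltW.
have step s : (s0 <= s)%N -> (forall x, 2 ^+ s <= x <= 2 ^+ s.+1 -> E x <= expR 1 * E (2 ^+ s)) /\
    E (2 ^+ s.+1) <= E (2 ^+ s) / 4.
  move=> ss; have [v [dv [vs uv]]] :=
    std_sol_restrict (k_gt0 j) (Qa s.+1) us (fun x xs => esym (qQ s.+1 x xs)).
  have [_ _ _ /(_ j (s0P s ss) v dv vs)[/= H1 H2]] := QP s.
  have p0 t : 0 <= 2 ^+ t :> R by rewrite exprn_ge0.
  have uvs : E (2 ^+ s) = energy (k j ^+ 2) v dv (2 ^+ s).
    by rewrite /E uv// p0 two_mono.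
  split=> [x /andP[sx1 sx2]|]; last by rewrite uvs /E uv ?p0 ?lexx.
  by rewrite uvs /E uv ?sx2 ?(le_trans _ sx1)// H1// sx1.
have [C CE] : exists C, C = E (2 ^+ s0) * 4 ^+ s0 by eexists.
have decay s : (s0 <= s)%N -> E (2 ^+ s) * 4 ^+ s <= C.
  elim: s => [|s IH]; first by rewrite leqn0 => /eqP s00; rewrite CE s00.
  rewrite leq_eqVlt => /predU1P[<-|ss]; first by rewrite CE.
  rewrite (le_trans _ (IH ss))//.
  rewrite [4 ^+ _]exprS mulrA ler_wpM2r ?exprn_ge0// -ler_pdivlMr//.
  by case: (step s ss).
have uc : continuous (fun x => u x ^+ 2 * (1 + x ^+ 2)).
  have [[ud _] _] := us; eapply has_deriv_continuous => x; repeat der_step.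
have [M M0 MP] := bounded_on_segment 0 (2 ^+ s0) uc.
(* [M] covers the segment before [k j] is permanently active. Beyond it, u^2 <= E / k^2, E <= e C /
   4^s, x^2 <= 4 * 4^s and 1 + x^2 <= 2 x^2. *)
exists (M + 2 * ((k j ^+ 2)^-1 * (expR 1 * C * 4))) => x x0.
have C0 : 0 <= C by rewrite CE mulr_ge0// exprn_ge0.
have kC0 : 0 <= (k j ^+ 2)^-1 * (expR 1 * C * 4).
  by rewrite !mulr_ge0// ?expR_ge0// invr_ge0 ltW.
have [xs|xs] := leP x (2 ^+ s0).
  rewrite (@le_trans _ _ M)//; last by rewrite lerDl mulr_ge0.
  by rewrite (le_trans (ler_norm _))// MP// x0.
rewrite (@le_trans _ _ (2 * ((k j ^+ 2)^-1 * (expR 1 * C * 4))))//; last first.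
  by rewrite lerDr ltW.
have x1 : 1 <= x by rewrite (le_trans (two_ge1 s0))// ltW.
have x21 : 1 <= x ^+ 2 by rewrite exprn_ege1.
apply: (@le_trans _ _ (2 * (u x ^+ 2 * x ^+ 2))).
  by rewrite mulrCA ler_wpM2l ?sqr_ge0// mulr_natl mulr2n lerD2r.
rewrite ler_wpM2l//.
have [s /andP[sx1 sx2]] := dyadic_cover x1.
have ss : (s0 <= s)%N.
  rewrite leqNgt; apply/negP => ss; have := le_lt_trans (le_trans sx2 (two_mono _ _ ss)) xs.
  by rewrite ltxx.
have x2b : x ^+ 2 <= 4 * 4 ^+ s.
  rewrite -exprS (_ : 4 = 2 ^+ 2); last by ring.
  by rewrite -exprM mulnC exprM lerXn2r ?nnegrE ?exprn_ge0.
have [H1 _] := step s ss.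
have uE : u x ^+ 2 <= (k j ^+ 2)^-1 * E x.
  by have := sqr_energy_le u du x k20; rewrite ger0_norm// sqr_ge0.
apply: (@le_trans _ _ ((k j ^+ 2)^-1 * E x * (4 * 4 ^+ s))).
  by rewrite ler_pM ?sqr_ge0.
have ik0 : 0 <= (k j ^+ 2)^-1 by rewrite invr_ge0 ltW.
rewrite -!mulrA ler_wpM2l//.
apply: (@le_trans _ _ (expR 1 * E (2 ^+ s) * (4 * 4 ^+ s))).
  by rewrite ler_wpM2r ?H1 ?sx1// mulr_ge0// exprn_ge0.
rewrite (_ : expR 1 * E (2 ^+ s) * _ = expR 1 * 4 * (E (2 ^+ s) * 4 ^+ s)); last by ring.
rewrite (_ : expR 1 * (C * 4) = expR 1 * 4 * C); last by ring.
by apply: ler_wpM2l (decay s ss); rewrite mulr_ge0 ?expR_ge0.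
Unshelve. all: by end_near. Qed.

End HalfLine.

(** * The whole line *)

Section WholeLine.
Variable R : realType.
Implicit Types (q u du : R -> R) (k x y B : R) (n s t j : nat).

Lemma integral_oneDsqrV_lty (B : R) : 0 <= B ->
  (\int[@lebesgue_measure R]_x (B * (oneDsqr x)^-1)%:E < +oo)%E.
Proof.
move=> B0; rewrite ge0_symfun_integralT//=.
- rewrite (_ : [set x | _] = `[0, +oo[%classic); last first.
    by apply/seteqP; split => x/=; rewrite in_itv/= andbT.
  under eq_integral do rewrite EFinM.
  rewrite ge0_integralZl//=.
  + by rewrite integral0y_oneDsqr -!EFinM ltry.
  + apply/measurable_EFinP/measurable_funTS.
    by apply: continuous_measurable_fun => x; exact: continuous_oneDsqrV.
- by move=> x; apply: divr_ge0 => //; exact: le_trans ler01 (oneDsqr_ge1 x).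
- by move=> x; apply: cvgM; [exact: cvg_cst|exact: continuous_oneDsqrV].
- by move=> x /=; rewrite /oneDsqr sqrrN.
Qed.

Lemma Lfun2_decay u B : continuous u -> (forall x, u x ^+ 2 * (1 + x ^+ 2) <= B) ->
  u \in Lfun (@lebesgue_measure R) 2%:E.
Proof.
move=> uc uB; have mu : measurable_fun setT u by exact: continuous_measurable_fun.
have B0 : 0 <= B by rewrite (le_trans _ (uB 0))// mulr_ge0 ?sqr_ge0// addr_ge0 ?sqr_ge0.
rewrite inE; apply/andP; split; rewrite inE//= /finite_norm unlock /Lnorm.
apply: poweR_lty; apply: le_lt_trans (integral_oneDsqrV_lty B0).
apply: ge0_le_integral => //.
- by move=> x _; rewrite poweR_ge0.
- apply/measurable_EFinP => /=.
  apply/(@measurableT_comp _ _ _ _ _ _ (fun x : R => x `^ 2)%R) => //.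
  exact/measurableT_comp.
- apply/measurable_EFinP; apply: continuous_measurable_fun => x.
  by apply: cvgM; [exact: cvg_cst|exact: continuous_oneDsqrV].
- move=> x _ /=; rewrite lee_fin powR_mulrn// real_normK ?num_real//.
  by rewrite ler_pdivlMr ?uB// /oneDsqr ltr_wpDr ?sqr_ge0.
Qed.

(** On [-1, 1] both [u x] and [u (- x)] equal [cos (k * x)]. Subtracting this cosine from their sum
    gives one formula that is [u x] for [x >= - 1] and [u (- x)] for [x <= 1], so no gluing at 0 is
    required. *)
Lemma even_extension q k u du B : 0 < k -> (forall x, x <= 1 -> q x = 0) ->
  std_sol q k u du -> (forall x, 0 <= x -> u x ^+ 2 * (1 + x ^+ 2) <= B) ->
  has_L2_solution (fun x => q x + q (- x)) (k ^+ 2).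
Proof.
move=> k0 q1 [[ud dud] uE] uB.
pose U x := u x + u (- x) - cos (k * x).
pose dU x := du x - du (- x) + k * sin (k * x).
have Upos x : - 1 <= x -> U x = u x.
  by move=> x1; rewrite /U [u (- x)]uE ?mulrN ?cosN ?addrK// lerNl.
have Uneg x : x <= 1 -> U x = u (- x).
  by move=> x1; rewrite /U uE// addrAC subrr add0r.
have Ud : has_deriv U dU by move=> x; rewrite /U /dU; der; ring.
have dUd : has_deriv dU (fun x => (q x + q (- x) - k ^+ 2) * U x).
  move=> x; rewrite /dU; der.
  have [x1|x1] := leP x 1.
    by rewrite Uneg// q1// uE//; ring.
  have x2 : - x <= 1 by lra.
  have ux : u (- x) = cos (k * x) by rewrite uE// mulrN cosN.
  by rewrite Upos; [rewrite (q1 _ x2) ux; ring|lra].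
exists U; split.
- split; [by move=> x; exact: has_deriv_derivable Ud| |].
    by rewrite (has_derivE Ud) => x; exact: has_deriv_derivable dUd.
  move=> x; rewrite derive1nS derive1n1 (has_derivE Ud) (has_derivE dUd); ring.
- exists 0; rewrite Upos ?uE ?mulr0 ?cos0 ?oner_neq0//; lra.
- apply: (@Lfun2_decay _ B); first exact: has_deriv_continuous Ud.
  move=> x; have [x0|x0] := leP 0 x.
    by rewrite Upos ?uB//; lra.
  by rewrite Uneg; [rewrite -[x ^+ 2]sqrrN uB//|]; lra.
Qed.

Lemma whole_line_potential (k : nat -> R) : (forall j, 0 < k j) ->
  exists K T : nat -> R, [/\ K 0%N = 0, T 0%N = 0,
  (forall n, 0 <= K n) & forall N : nat -> nat,
  (forall s, T (N s) <= 2 ^+ s) -> (forall s, K (N s) <= 2 ^+ s) ->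
  exists q, [/\ smooth q, forall x, `|x| <= 1 -> q x = 0,
    forall s x, 2 ^+ s <= `|x| -> `|x| <= 2 ^+ s.+1 ->
      `|q x| <= 3 * K (N s) / (`|x| + 1) &
    forall j, (exists s0, forall s, (s0 <= s)%N -> (j < N s)%N) ->
      has_L2_solution q (k j ^+ 2)]].
Proof.
move=> k0; have [K [T [K0 T0 Kge0 KT]]] := half_line_potential k0.
exists K, T; split=> // N NT NK; have [q [qs q1 qb qsol]] := KT N NT NK.
have Q_abs x : q x + q (- x) = q `|x|.
  have [x0|x0] := leP 0 x.
    by rewrite ger0_norm// [q (- x)]q1 ?addr0// (le_trans _ ler01)// oppr_le0.
  by rewrite ltr0_norm// q1 ?add0r// (le_trans _ ler01)// ltW.
exists (fun x => q x + q (- x)); split.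
- have Ns : smooth (fun x : R => - x) := smoothN (@smooth_id R).
  exact: smoothD qs (smooth_comp qs Ns).
- by move=> x x1; rewrite Q_abs q1.
- move=> s x sx xs; rewrite Q_abs (le_trans (qb s `|x| _)) ?sx//.
  have s1 : 1 <= 2 ^+ s :> R by rewrite exprn_ege1// ler1n.
  have s0 : 0 < 2 ^+ s :> R by rewrite exprn_gt0.
  (* The factor 3 comes from [|x| + 1 <= 2 * 2 ^+ s + 1 <= 3 * 2 ^+ s]. *)
  rewrite ler_pdivrMr// mulrAC ler_pdivlMr ?ltr_wpDl// [3 * _]mulrC -mulrA ler_wpM2l//.
  by move: xs; rewrite exprS; lra.
- move=> j /qsol[u [du [us [B uB]]]]; exact: even_extension us uB.
Qed.

End WholeLine.

Theorem theorem1p5 (R : realType) (Lambda : set R)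
    (Lambda_gt0 : forall l : R, Lambda l -> 0 < l) :
  (finite_set Lambda ->
   exists q : R -> R,
     [/\ smooth q,
         forall l : R, Lambda l -> has_L2_solution q l
       & exists M : R, forall x : R, `|q x| <= M / (`|x| + 1)]) /\
  (countable Lambda ->
   forall C : R -> R,
     (forall x : R, 0 < x -> 0 < C x) ->
     C x @[x --> +oo] --> +oo ->
     exists q : R -> R,
       [/\ smooth q,
           forall l : R, Lambda l -> has_L2_solution q l
         & forall x : R, x != 0 -> `|q x| <= C `|x| / (`|x| + 1)]).
Proof.
have pow2 (x : R) : exists s0 : nat, forall s, (s0 <= s)%N -> x <= 2 ^+ s.
  have [s /andP[_ xs]] := @dyadic_cover R (Num.max 1 x) ltac:(by rewrite le_max lexx).
  exists s.+1 => t st; rewrite (@le_trans _ _ (2 ^+ s.+1))//.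
    by rewrite (le_trans _ xs)// le_max lexx orbT.
  by rewrite ler_weXn2l// ler1n.
have abs1 (x : R) : 0 < `|x| + 1 by rewrite ltr_wpDl.
split.
  move=> /finite_seqP[S SE].
  (* The sequence must be infinite and positive; the padding value 1 is never activated, as [N]
     stays at most [size S]. *)
  pose l j := if (j < size S)%N then nth 0 S j else 1.
  have l0 j : 0 < l j.
    rewrite /l; case: ifP => // jS; apply: Lambda_gt0; rewrite SE; exact: mem_nth.
  have [K [T [K0 T0 Kge0 KT]]] :=
    whole_line_potential (fun j => ltac:(by rewrite sqrtr_gt0; exact: l0) : 0 < Num.sqrt (l j)).
  have [s1 s1P] := pow2 (T (size S)); have [s2 s2P] := pow2 (K (size S)).
  pose N s := if (maxn s1 s2 <= s)%N then size S else 0%N.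
  have [||q [qs q1 qb qsol]] := KT N.
  - move=> s; rewrite /N; case: ifP => [|_]; last by rewrite T0 exprn_ge0.
    by rewrite geq_max => /andP[/s1P].
  - move=> s; rewrite /N; case: ifP => [|_]; last by rewrite K0 exprn_ge0.
    by rewrite geq_max => /andP[_ /s2P].
  exists q; split=> // [x Lx|].
    have xS : x \in S by move: Lx; rewrite SE.
    have lx : l (index x S) = x by rewrite /l index_mem xS nth_index.
    rewrite -[x](sqr_sqrtr (ltW (Lambda_gt0 _ Lx))) -{1}lx; apply: qsol.
    by exists (maxn s1 s2) => s ss; rewrite /N ss index_mem.
  exists (3 * K (size S)) => x; have [x1|x1] := leP `|x| 1.
    by rewrite q1// normr0 divr_ge0 ?mulr_ge0// ltW.
  have [s /andP[sx xs]] := dyadic_cover (ltW x1).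
  rewrite (le_trans (qb s x sx xs))// ler_pM2r ?invr_gt0// ler_wpM2l//.
  by rewrite /N; case: ifP => // _; rewrite K0.
move=> /countable_injP[f finj] C C0 Cy.
(* Inverts the injection [f] on its image, with 1 at indices that are not attained. Such indices
   merely add the positive energy 1 to the list. *)
have /choice[l lP] : forall j, exists y : R, 0 < y /\ forall x, Lambda x -> f x = j -> y = x.
  move=> j; have [[x [Lx fx]]|nx] := pselect (exists x, Lambda x /\ f x = j).
    exists x; split=> [|z Lz fz]; first exact: Lambda_gt0.
    by apply: finj; rewrite ?inE// fx.
  by exists 1; split=> // x Lx fx; case: nx; exists x.
have [K [T [K0 T0 Kge0 KT]]] :=
  whole_line_potential (fun j => ltac:(by rewrite sqrtr_gt0; case: (lP j)) : 0 < Num.sqrt (l j)).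
(* States that [n] energies are affordable from stage [s] on. It always holds for [n = 0], by
   positivity of [C], and for each fixed [n] eventually, by divergence of [C]. *)
pose P n s := [/\ T n <= 2 ^+ s, K n <= 2 ^+ s & forall x, 2 ^+ s <= x -> 3 * K n <= C x].
have P0 s : P 0%N s.
  rewrite /P K0 T0 mulr0 !exprn_ge0//; split=> // x sx; apply/ltW/C0.
  by rewrite (lt_le_trans _ sx)// exprn_gt0.
have P_ev n : exists s0, forall s, (s0 <= s)%N -> P n s.
  have [s1 s1P] := pow2 (T n); have [s2 s2P] := pow2 (K n).
  have /cvgryPge/(_ (3 * K n)) [A [_ AP]] := Cy.
  (* The neighbourhood of infinity is given by a strict inequality, hence the shift by 1. *)
  have [s3 s3P] := pow2 (A + 1).
  exists (maxn s1 (maxn s2 s3)) => s; rewrite !geq_max => /and3P[ss1 ss2 ss3].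
  split; [exact: s1P|exact: s2P|move=> x sx; apply: AP].
  by rewrite (lt_le_trans _ sx)// (lt_le_trans _ (s3P s ss3))// ltrDl.
(* [N s] is the largest affordable number of energies that is at most [s]. The cap by [s] makes the
   maximum exist and still lets [N s] eventually exceed any given index. *)
have /choice[N NP] : forall s, exists n, P n s /\ forall m, (m <= s)%N -> P m s -> (m <= n)%N.
  move=> s; pose p n := (n <= s)%N && `[< P n s >].
  have p0 : exists n, p n by exists 0%N; rewrite /p leq0n; exact/asboolP.
  have pb n : p n -> (n <= s)%N by case/andP.
  case: (ex_maxnP p0 pb) => n /andP[_ /asboolP Pn] n_max.
  by exists n; split=> // m ms Pm; apply: n_max; rewrite /p ms; exact/asboolP.
have [||q [qs q1 qb qsol]] := KT N.
- by move=> s; have [[]] := NP s.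
- by move=> s; have [[]] := NP s.
exists q; split=> // [x Lx|x x0].
  have lx : l (f x) = x by have [_ lPx] := lP (f x); exact: lPx.
  rewrite -[x](sqr_sqrtr (ltW (Lambda_gt0 _ Lx))) -{1}lx; apply: qsol.
  have [s0 s0P] := P_ev (f x).+1.
  exists (maxn s0 (f x).+1) => s; rewrite geq_max => /andP[ss fs].
  by have [_] := NP s; apply=> //; exact: s0P.
have ax0 : 0 < `|x| by rewrite normr_gt0.
have [x1|x1] := leP `|x| 1.
  by rewrite q1// normr0 divr_ge0// ltW// C0.
have [s /andP[sx xs]] := dyadic_cover (ltW x1).
rewrite (le_trans (qb s x sx xs))// ler_pM2r ?invr_gt0//.
by have [[_ _ CP] _] := NP s; exact: CP.
Qed.
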